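(* Let $0<\delta<\infty$, let $\rho_\delta$ be a nonnegative spherically symmetric kernel (a function of Euclidean distance) compactly supported on $[0,\delta]$, and let $$\lambda_\delta(\boldsymbol{k})=\int_{B_\delta(\boldsymbol{0})}\rho_\delta(|\boldsymbol{r}|)\left(e^{\mathrm{i}\,\boldsymbol{k}\cdot\boldsymbol{r}}-1\right)d\boldsymbol{r}.$$ Let $k=|\boldsymbol{k}|$ and $r=|\boldsymbol{r}|$. The Fourier spectra of nonlocal diffusion may be reduced to the following one-dimensional integral: $$\lambda_\delta(\boldsymbol{k})=\int_0^\delta \rho_\delta(r)\left[(2\pi)^{\frac d2}\,\frac{J_{\frac{d-2}{2}}(kr)}{(kr)^{\frac{d-2}{2}}}-\frac{2\pi^{\frac d2}}{\Gamma(\frac d2)}\right]r^{d-1}\,dr.$$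
   Context: Here $d$ is the number of spatial dimensions (any positive integer), $|\cdot|$ is the Euclidean norm, and $B_\delta(\boldsymbol{x})=\{\boldsymbol{y}\in\mathbb{R}^d:|\boldsymbol{x}-\boldsymbol{y}|\le\delta\}$ is the closed ball of radius $\delta$ centred at $\boldsymbol{x}$. $J_\nu$ is the cylindrical Bessel function of the first kind of order $\nu$ and $\Gamma$ is the gamma function. For functions $u$ on the torus $\mathbb{T}^d=[0,2\pi)^d$, extended periodically to $\mathbb{R}^d$, the nonlocal diffusion operator is $\mathcal{L}_\delta u(\boldsymbol{x})=\int_{B_\delta(\boldsymbol{x})}\rho_\delta(|\boldsymbol{x}-\boldsymbol{y}|)[u(\boldsymbol{y})-u(\boldsymbol{x})]\,d\boldsymbol{y}$. The Fourier modes $e^{\mathrm{i}\boldsymbol{k}\cdot\boldsymbol{x}}$, with $\boldsymbol{k}\in\mathbb{Z}^d$, are its periodic eigenfunctions, $\mathcal{L}_\delta e^{\mathrm{i}\boldsymbol{k}\cdot\boldsymbol{x}}=\lambda_\delta(\boldsymbol{k})e^{\mathrm{i}\boldsymbol{k}\cdot\boldsymbol{x}}$, and the eigenvalues $\lambda_\delta(\boldsymbol{k})$ are called the Fourier spectra. *)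

(* Defs.v *)
From HB Require Import structures.
From mathcomp Require Import all_boot all_order all_algebra.
From mathcomp Require Import complex.
From mathcomp Require Import all_classical all_reals all_analysis.

Set Implicit Arguments.
Unset Strict Implicit.
Unset Printing Implicit Defensive.

Import Order.TTheory GRing.Theory Num.Theory.
Import numFieldNormedType.Exports.

Local Open Scope classical_set_scope.
Local Open Scope ring_scope.
Local Open Scope complex_scope.

(* Product measure of d copies of the Lebesgue measure on R, carried by the
   library's product sigma-algebra on d.-tuple R. *)
Fixpoint lebesgue_tuple (R : realType) (d : nat) :
    set (d.-tuple (measurableTypeR R)) -> \bar R :=
  match d with
  | 0%N => \d_ [tuple]
  | n.+1 => pushforward (@lebesgue_measure R \x @lebesgue_tuple R n)%E
              (fun x => [tuple of x.1 :: x.2])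
  end.
Arguments lebesgue_tuple : clear implicits.

Section sigma_finite_measure_exists.
Local Open Scope ereal_scope.
Context d (T : measurableType d) (R : realType) (f : set T -> \bar R).
Hypotheses (f0 : f set0 = 0) (f_ge0 : forall A, 0 <= f A).
Hypotheses (f_sigma_additive : semi_sigma_additive f).
Hypothesis f_sigma_finite : sigma_finite setT f.

Let g := f.

HB.instance Definition _ := isMeasure.Build _ _ _ g f0 f_ge0 f_sigma_additive.

HB.instance Definition _ := Measure_isSigmaFinite.Build _ _ _ g f_sigma_finite.

Lemma sigma_finite_measure_exists :
  exists m : {sigma_finite_measure set T -> \bar R}, m = f :> (set T -> _).
Proof. by exists g. Qed.

End sigma_finite_measure_exists.

Section lebesgue_tuple_measure.
Local Open Scope ereal_scope.
Variable R : realType.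
Local Notation mR := (measurableTypeR R).

Let tcons n (x : mR * n.-tuple mR) : n.+1.-tuple mR := [tuple of x.1 :: x.2].

Let tuncons n (x : n.+1.-tuple mR) : mR * n.-tuple mR :=
  (thead x, [tuple of behead x]).

Let measurable_tcons n : measurable_fun [set: _] (@tcons n).
Proof. exact: measurable_cons. Qed.

Let measurable_tuncons n : measurable_fun [set: _] (@tuncons n).
Proof.
apply: measurable_fun_pair; first exact: measurable_tnth.
exact: measurable_behead.
Qed.

Let tconsK n : cancel (@tcons n) (@tuncons n).
Proof. by move=> [x t]; rewrite /tuncons theadE; congr (_, _); apply: val_inj. Qed.

Let lebesgue_tuple_axioms n : let mu := lebesgue_tuple R n in
  [/\ mu set0 = 0, forall A, 0 <= mu A, semi_sigma_additive mu &
      sigma_finite setT mu].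
Proof.
elim: n => [|n [m0 mge0 madd msf]] /=.
  split; [exact: measure0|exact: measure_ge0|exact: measure_semi_sigma_additive|].
  exact: sigma_finiteT.
have [mu muE] := sigma_finite_measure_exists m0 mge0 madd msf.
rewrite -muE -[fun x => _]/(@tcons n).
pose nu : {measure set (mR * n.-tuple mR)%type -> \bar R} :=
  (@lebesgue_measure R \x mu).
rewrite -[(_ \x _)]/(nu : set _ -> _).
have [p pE] : exists p : {measure set (n.+1.-tuple mR) -> \bar R},
    p = pushforward nu (@tcons n) :> (set _ -> _).
  by exists (measure_function_pushforward__canonical__measure_function_Measure
    nu (@measurable_tcons n)).
split; rewrite -?pE; [exact: measure0|exact: measure_ge0|
  exact: measure_semi_sigma_additive|].
have /sigma_finiteP[F [TF ndF Foo]] := sigma_finiteT (@lebesgue_measure R).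
have /sigma_finiteP[G [TG ndG Goo]] := sigma_finiteT mu.
exists (fun i => @tuncons n @^-1` (F i `*` G i)).
  apply/esym/seteqP; split => // x _.
  have [i _ Fi] : (\bigcup_i F i) (tuncons x).1 by rewrite -TF.
  have [j _ Gj] : (\bigcup_i G i) (tuncons x).2 by rewrite -TG.
  exists (maxn i j) => //; split.
  - by move: Fi; exact/subsetPset/ndF/leq_maxl.
  - by move: Gj; exact/subsetPset/ndG/leq_maxr.
move=> i; have [mF Fi] := Foo i; have [mG Gi] := Goo i; split.
  rewrite -[X in measurable X]setTI; apply: measurable_tuncons => //.
  exact: measurableX.
rewrite pE /pushforward -comp_preimage (_ : _ \o _ = id) ?preimage_id.
  by rewrite /nu/= product_measure1E// lte_mul_pinfty// ge0_fin_numE.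
exact/funext/tconsK.
Qed.

Let lebesgue_tuple0 n : lebesgue_tuple R n set0 = 0.
Proof. by have [] := lebesgue_tuple_axioms n. Qed.

Let lebesgue_tuple_ge0 n A : 0 <= lebesgue_tuple R n A.
Proof. by have [] := lebesgue_tuple_axioms n. Qed.

Let lebesgue_tuple_sigma_additive n : semi_sigma_additive (lebesgue_tuple R n).
Proof. by have [] := lebesgue_tuple_axioms n. Qed.

HB.instance Definition _ n := isMeasure.Build _ _ _ (lebesgue_tuple R n)
  (lebesgue_tuple0 n) (@lebesgue_tuple_ge0 n) (@lebesgue_tuple_sigma_additive n).

Let lebesgue_tuple_sigma_finite n : sigma_finite setT (lebesgue_tuple R n).
Proof. by have [] := lebesgue_tuple_axioms n. Qed.

HB.instance Definition _ n := Measure_isSigmaFinite.Build _ _ _ (lebesgue_tuple R n)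
  (lebesgue_tuple_sigma_finite n).

Lemma lebesgue_tuple_box n (A : 'I_n -> set mR) :
  (forall i, measurable (A i)) ->
  lebesgue_tuple R n [set x | forall i, A i (tnth x i)] =
  \prod_(i < n) lebesgue_measure (A i).
Proof.
elim: n A => [|n IH] A mA.
  by rewrite big_ord0 /= diracE mem_set// => -[].
rewrite big_ord_recl -(IH (fun i => A (lift ord0 i)))//.
rewrite -product_measure1E//=; last first.
  rewrite (_ : [set _ | _] =
      \bigcap_(i in [set: 'I_n]) ((@tnth n mR ^~ i) @^-1` A (lift ord0 i))).
    apply: fin_bigcap_measurable => // i _; rewrite -[X in measurable X]setTI.
    exact: measurable_tnth.
  by apply/seteqP; split => x /= xA i; [move=> _|]; exact: xA.
rewrite /pushforward; congr (_ _); apply/seteqP; split => -[x t] /=.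
  move=> At; split; first exact: (At ord0).
  by move=> i; have := At (lift ord0 i); rewrite tnthS.
move=> [Ax At] i; have [j ->|->//] := unliftP ord0 i.
by rewrite tnthS; exact: At.
Qed.

End lebesgue_tuple_measure.

(* Rintegral is total: a component whose integral is infinite or undefined is
   assigned the value 0. *)
Definition Cintegral d (T : measurableType d) (R : realType)
    (mu : {measure set T -> \bar R}) (D : set T) (f : T -> R[i]) : R[i] :=
  (\int[mu]_(x in D) complex.Re (f x)) +i* (\int[mu]_(x in D) complex.Im (f x)).

Definition expi (R : realType) (t : R) : R[i] := cos t +i* sin t.

Definition dotp (R : realType) (d : nat) (x y : d.-tuple R) : R :=
  \sum_(i < d) tnth x i * tnth y i.

Definition enorm (R : realType) (d : nat) (x : d.-tuple R) : R :=
  Num.sqrt (dotp x x).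

Definition real_tuple (R : realType) (d : nat) (k : d.-tuple int) : d.-tuple R :=
  [tuple (tnth k i)%:~R | i < d].

(* Euler's integral, valid for 0 < z. *)
Definition Gamma (R : realType) (z : R) : R :=
  \int[@lebesgue_measure R]_(t in `]0, +oo[) (t `^ (z - 1) * expR (- t)).

(* Only for real orders -1 < nu, where every Gamma value below is given by
   Euler's integral, and for 0 < x, where powR is the usual real power. *)
Definition besselJ (R : realType) (nu x : R) : R :=
  limn (series (fun m : nat =>
    (-1) ^+ m / (m`!%:R * Gamma (m%:R + nu + 1))
      * (x / 2) `^ (2 * m%:R + nu))).

(* J_nu(z) / z^nu, extended by continuity to z = 0. *)
Definition besselJ_ratio (R : realType) (nu z : R) : R :=
  if z == 0 then lim (besselJ nu x / x `^ nu @[x --> 0^'+])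
  else besselJ nu z / z `^ nu.

Definition fourier_spectrum (R : realType) (d : nat) (delta : R) (rho : R -> R)
    (k : d.-tuple int) : R[i] :=
  Cintegral (lebesgue_tuple R d) [set r | enorm r <= delta]
    (fun r => (rho (enorm r))%:C * (expi (dotp (real_tuple R k) r) - 1)).

(* Main.v *)
From HB Require Import structures.
Require Import Defs.
From mathcomp Require Import all_boot all_order all_algebra.
From mathcomp Require Import complex.
From mathcomp Require Import all_classical all_reals all_analysis.
From mathcomp Require Import measurable_realfun.
From mathcomp Require Import ring lra.

(** Both sides are compared through their Gaussian transforms, which replaces
    polar coordinates and rotation invariance altogether.

    Push the measure (1 - cos (k . x)) dx on R^d forward along x |-> |x|^2. Its
    Laplace transform is the integral of exp (- t |x|^2) (1 - cos (k . x)),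
    which factorizes over the coordinates and equals
    (pi / t)^(d/2) (1 - exp (- |k|^2 / 4t)); this is [integral_gauss_cos_tuple].
    The measure W(r) dr on the half-line, where
    W(r) = (2 pi^(d/2) / Gamma(d/2)) (1 - Omega_d (|k| r)) r^(d-1) and Omega_d
    is the normalized Bessel function Gamma(d/2) (2/z)^nu J_nu(z) with
    nu = (d-2)/2, has the same transform: integrating the power series of
    Omega_d term by term against a Gaussian turns the m-th term into the m-th
    term of exp (- |k|^2 / 4t), by the recurrence for the moments of the
    Gaussian; this is [integral_gauss_radial_cos]. A measure on the half-line
    is determined by its Laplace transform at the positive integers
    ([laplace_unique]), so the two measures agree and every function of |x| may
    be integrated against either of them.

    No integrability of rho is available, so everything is done for nonnegative
    functions with values in the extended reals. This requires W >= 0, which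
    the uniqueness theorem itself provides: it is applied to
    (1 - cos (k . x)) dx + W^- dr and W^+ dr, and testing the resulting identity
    on the set where W < 0 shows that W^- vanishes almost everywhere
    ([radial_reduction]). The imaginary part is handled in the same way: the
    positive and the negative part of sin (k . x) have the same Laplace
    transform, hence the same integral against every nonnegative function of
    |x| ([radial_sin_cancel]). *)

Set Implicit Arguments.
Unset Strict Implicit.
Unset Printing Implicit Defensive.

Import Order.TTheory GRing.Theory Num.Theory.
Import numFieldNormedType.Exports.
Import HBNNSimple.

Local Open Scope classical_set_scope.
Local Open Scope ring_scope.

(** * Weighted image measures *)

Section density_measure.
Local Open Scope ereal_scope.
Context d (T : measurableType d) (R : realType) (m : {measure set T -> \bar R}).
Variable w : T -> R.
Hypotheses (mw : measurable_fun [set: T] w) (w_ge0 : forall x, (0 <= w x)%R).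

Let nu A := \int[m]_(x in A) (w x)%:E.

Let nu0 : nu set0 = 0. Proof. exact: integral_set0. Qed.

Let nu_ge0 A : 0 <= nu A.
Proof. by apply: integral_ge0 => x _; rewrite lee_fin. Qed.

Let nu_sigma_additive : semi_sigma_additive nu.
Proof.
apply: semi_sigma_additive_nng_induced; first exact/measurable_EFinP.
by move=> x; rewrite lee_fin.
Qed.

HB.instance Definition _ :=
  isMeasure.Build _ _ _ nu nu0 nu_ge0 nu_sigma_additive.

(* For simple functions the claim is linear in the indicators of the level sets,
   where it is the definition of [nu]. *)
Let nu_nnsfun (h : {nnsfun T >-> R}) :
  \int[m]_x ((h x)%:E * (w x)%:E) = \int[nu]_x (h x)%:E.
Proof.
have mwE : measurable_fun [set: T] (EFin \o w) by exact/measurable_EFinP.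
have mind r : measurable_fun [set: T] (fun x => (r * \1_(h @^-1` [set r]) x)%:E).
  by apply/measurable_EFinP; exact: measurable_funM.
have ind_ge0 r x : 0 <= (r * \1_(h @^-1` [set r]) x)%:E.
  exact: nnfun_muleindic_ge0.
transitivity (\int[nu]_x
   (\sum_(y \in range h) (y * \1_(h @^-1` [set y]) x)%:E)); last first.
  by apply: eq_integral => t tE; rewrite fimfunE -fsumEFin.
rewrite ge0_integral_fsum//.
transitivity (\int[m]_x (\sum_(y \in range h)
    (y * \1_(h @^-1` [set y]) x)%:E * (w x)%:E)).
  under [RHS]eq_integral => x xE.
    rewrite -ge0_mule_fsuml => [|y]; last exact: nnfun_muleindic_ge0.
    rewrite fsumEFin // -(fimfunE _ x); over.
  by [].
rewrite ge0_integral_fsum//; last 2 first.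
  - by move=> y; exact: emeasurable_funM.
  - by move=> y x _; apply: mule_ge0; rewrite ?ind_ge0 ?lee_fin.
apply: eq_fsbigr => r rh.
have mpre : measurable (h @^-1` [set r]) by [].
rewrite integralZl_indic_nnsfun//.
under eq_integral do rewrite EFinM -muleA.
rewrite ge0_integralZl//.
- rewrite integral_indic// setIT; congr (_ * _).
  rewrite /= /nu [RHS]integral_mkcond; apply: eq_integral => x _.
  by rewrite epatch_indic muleC.
- by apply: emeasurable_funM => //; exact/measurable_EFinP.
- by move=> x _; rewrite mule_ge0 ?lee_fin.
- by move: rh; rewrite inE => -[t _ <-]; rewrite lee_fin.
Qed.

(** The measure with density [w] with respect to [m]; it is only given by its
    action on nonnegative functions, which determines it. *)
Lemma density_measure_exists :
  exists nu : {measure set T -> \bar R}, forall g : T -> \bar R,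
    measurable_fun [set: T] g -> (forall x, 0 <= g x) ->
    \int[nu]_x g x = \int[m]_x (g x * (w x)%:E).
Proof.
exists nu => g mg g0.
pose h := nnsfun_approx measurableT mg.
have cvgh x : (h n x)%:E @[n --> \oo] --> g x by exact: cvg_nnsfun_approx.
transitivity (limn (fun n => \int[nu]_x (h n x)%:E)).
  have gE x : g x = limn (fun n => (h n x)%:E) by apply/esym/cvg_lim.
  under eq_integral do rewrite gE.
  apply: monotone_convergence => //.
  - by move=> n; exact/measurable_EFinP.
  - by move=> n x _; rewrite lee_fin.
  - by move=> x _ a b ab; rewrite lee_fin; exact/lefP/nd_nnsfun_approx.
have gE x : g x * (w x)%:E = limn (fun n => (h n x)%:E * (w x)%:E).
  by apply/esym/cvg_lim => //; exact: cvgeZr.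
under [RHS]eq_integral do rewrite gE.
rewrite monotone_convergence//.
- by under [in RHS]eq_fun do rewrite nu_nnsfun.
- by move=> n; apply: emeasurable_funM; exact/measurable_EFinP.
- by move=> n x _; rewrite mule_ge0 ?lee_fin.
- move=> x _ a b ab; rewrite lee_wpmul2r ?lee_fin//.
  exact/lefP/nd_nnsfun_approx.
Qed.

End density_measure.

Lemma weighted_image_exists d (T : measurableType d) (R : realType)
    (m : {measure set T -> \bar R}) (h : T -> measurableTypeR R) (w : T -> R) :
  measurable_fun [set: T] h -> measurable_fun [set: T] w ->
  (forall x, 0 <= w x) ->
  exists nu : {measure set (measurableTypeR R) -> \bar R},
    forall g : R -> \bar R, measurable_fun [set: measurableTypeR R] g ->
    (forall y, (0 <= g y)%E) ->
    (\int[nu]_y g y = \int[m]_x (g (h x) * (w x)%:E))%E.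
Proof.
move=> mh mw w0; have [nu nuE] := density_measure_exists m mw w0.
exists (measure_function_pushforward__canonical__measure_function_Measure nu mh).
move=> g mg g0; rewrite ge0_integral_pushforward//.
by rewrite preimage_setT nuE//; [exact: (measurableT_comp mg mh)|by move=> x /=].
Qed.

(** * A measure on the half-line is determined by its Laplace transform *)

Lemma bernoulli_ge (R : realType) (q : R) n :
  0 <= q <= 1 -> 1 - n%:R * q <= (1 - q) ^+ n.
Proof.
move=> /andP[q0 q1]; elim: n => [|n IH]; first by rewrite mul0r subr0 expr0.
rewrite exprS (le_trans _ (ler_wpM2l _ IH)) ?subr_ge0//.
have : 0 <= n%:R * (q * q) by rewrite !mulr_ge0.
by rewrite -natr1; nra.
Qed.

(** With N = N_n slightly above n exp (n a), the function
    (1 - exp (- n x))^N is close to exp (- n exp (n (a - x))): it tends to 0 for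
    x < a and to 1 for x > a. The extra factor n makes the limit at x = a equal
    to 0, so that the limit is exactly the indicator of the open ray. *)
Definition ray_exponent (R : realType) (a : R) (n : nat) : nat :=
  (Num.truncn (n.+1%:R * expR (n.+1%:R * a))).+1.

Definition ray_test (R : realType) (a : R) (n : nat) (x : R) : R :=
  (1 - expR (- (n.+1%:R * x))) ^+ ray_exponent a n.

Lemma ray_test01 (R : realType) (a x : R) n :
  0 <= x -> 0 <= ray_test a n x <= 1.
Proof.
move=> x0; have cx : 0 <= n.+1%:R * x by rewrite mulr_ge0.
have q1 : expR (- (n.+1%:R * x)) <= 1 by rewrite expR_le1 oppr_le0.
by rewrite exprn_ge0 ?exprn_ile1 ?subr_ge0// gerBl expR_ge0.
Qed.

(** Polynomials in exp (- x) that are bounded by 1 and converge everywhere on the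
    half-line to the indicator of a ray: these replace the Weierstrass
    approximation theorem in the proof of uniqueness. *)
Lemma cvg_ray_test (R : realType) (a x : R) : 0 <= a -> 0 <= x ->
  ray_test a n x @[n --> \oo] --> (\1_`]a, +oo[ x : R).
Proof.
move=> a0 x0; rewrite indicE mem_setE in_itv/= andbT.
have c0 n : 0 < n.+1%:R :> R by rewrite ltr0n.
have Ngt n : n.+1%:R * expR (n.+1%:R * a) <= (ray_exponent a n)%:R :> R.
  exact/ltW/truncnS_gt.
have Nle n : (ray_exponent a n)%:R <= n.+1%:R * expR (n.+1%:R * a) + 1 :> R.
  by rewrite /ray_exponent -natr1 lerD2r truncn_le mulr_ge0 ?expR_ge0.
have [ax|xa] := ltP a x.
- pose b := x - a; have b0 : 0 < b by rewrite subr_gt0.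
  apply: (@squeeze_cvgr _ _ _ R (fun n => 1 - 4 / b ^+ 2 * harmonic n)
    (fun=> 1)); last exact: cvg_cst.
  (* By Bernoulli, 1 - test <= N exp (- n x) <= 2 n exp (- n b), and
     exp (n b) >= (n b)^2 / 2. *)
  + apply: nearW => n; rewrite (andP (ray_test01 a n x0)).2 andbT.
    have q1 : expR (- (n.+1%:R * x)) <= 1 by rewrite expR_le1 oppr_le0 mulr_ge0.
    apply: le_trans (bernoulli_ge _ _); last by rewrite expR_ge0 q1.
    rewrite lerD2l lerN2.
    have le2 : (ray_exponent a n)%:R <= 2 * (n.+1%:R * expR (n.+1%:R * a)) :> R.
      have : 1 <= n.+1%:R * expR (n.+1%:R * a).
        by rewrite -[leLHS]mulr1 ler_pM// ?ler1n// -expR0 ler_expR mulr_ge0.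
      by have := Nle n; lra.
    apply: (le_trans (ler_wpM2r (expR_ge0 _) le2)).
    rewrite -!mulrA -expRD -mulrBr -opprB mulrN -/b expRN /harmonic/=.
    have eb : (n.+1%:R * b) ^+ 2 / 2 <= expR (n.+1%:R * b).
      have := @expR_ge1Dxn R (n.+1%:R * b) 1 (mulr_ge0 (ltW (c0 n)) (ltW b0)).
      by apply: le_trans; rewrite lerDr.
    rewrite mulrA ler_pdivrMr ?expR_gt0//; apply: le_trans (ler_wpM2l _ eb); last first.
      by rewrite !mulr_ge0 ?invr_ge0 ?exprn_ge0// ltW.
    rewrite le_eqVlt; apply/orP; left; apply/eqP.
    by field; rewrite gt_eqF//= gt_eqF.
  + rewrite -[X in _ --> X]subr0; apply: cvgB; first exact: cvg_cst.
    rewrite -[X in _ --> X](mulr0 (4 / b ^+ 2)).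
    by apply: cvgM; [exact: cvg_cst|exact: cvg_harmonic].
- apply: (@squeeze_cvgr _ _ _ R (fun=> 0) (fun n => harmonic n));
    [|exact: cvg_cst|exact: cvg_harmonic].
  apply: nearW => n; rewrite (andP (ray_test01 a n x0)).1/=.
  have q1 : expR (- (n.+1%:R * x)) <= 1 by rewrite expR_le1 oppr_le0 mulr_ge0.
  (* test <= exp (- N exp (- n x)) <= exp (- n exp (n (a - x))) <= exp (- n). *)
  apply: (@le_trans _ _ (expR (- n.+1%:R))); last first.
    rewrite expRN /harmonic lef_pV2 ?posrE ?expR_gt0//.
    by rewrite (le_trans _ (expR_ge1Dx _))// lerDr.
  rewrite /ray_test.
  apply: (@le_trans _ _ (expR (- expR (- (n.+1%:R * x))) ^+ ray_exponent a n)).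
    by rewrite lerXn2r ?nnegrE ?subr_ge0 ?expR_ge0// expR_ge1Dx.
  rewrite -expRM_natl ler_expR mulrN lerN2.
  apply: le_trans (ler_wpM2r (expR_ge0 _) (Ngt n)).
  rewrite -mulrA -expRD -[leLHS]mulr1 ler_pM2l//.
  by rewrite -[leLHS]expR0 ler_expR subr_ge0 ler_wpM2l.
Qed.

Section laplace_uniqueness.
Context (R : realType).
Local Notation mR := (measurableTypeR R).
Local Notation D := (`[0%R, +oo[%classic : set mR).

Let exp_decay (j : nat) (x : R) : R := expR (- (j%:R * x)).

Let measurable_exp_decay j : measurable_fun [set: mR] (exp_decay j).
Proof.
by apply: measurableT_comp => //; exact: measurableT_comp.
Qed.

Let measurable_ray_test a n : measurable_fun [set: mR] (ray_test a n).
Proof.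
apply: measurable_funX; apply: measurable_funB => //.
exact: (measurable_exp_decay n.+1).
Qed.

Let integrable_exp_decay (k : {measure set mR -> \bar R}) j :
  (k D < +oo)%E -> k.-integrable D (EFin \o exp_decay j).
Proof.
move=> kfin; apply: measurable_bounded_integrable => //.
  exact: measurable_funTS.
exists 1; split=> // M M1 x; rewrite /= in_itv/= andbT => x0.
rewrite ger0_norm ?expR_ge0// (le_trans _ (ltW M1))//.
by rewrite expR_le1 oppr_le0 mulr_ge0.
Qed.

Let ray_testE a n x : ray_test a n x = \sum_(i < (ray_exponent a n).+1)
  ((-1) ^+ i *+ 'C(ray_exponent a n, i)) * exp_decay (n.+1 * i) x.
Proof.
rewrite /ray_test exprBn; apply: eq_bigr => i _.
rewrite expr1n mulr1 [RHS]mulrnAl; congr (_ * _ *+ _).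
by rewrite /exp_decay -expRM_natr natrM; congr expR; ring.
Qed.

Let integral_ray_test (k : {measure set mR -> \bar R}) a n :
  (k D < +oo)%E ->
  (\int[k]_(x in D) (ray_test a n x)%:E = \sum_(i < (ray_exponent a n).+1)
    ((-1) ^+ i *+ 'C(ray_exponent a n, i))%:E *
    \int[k]_(x in D) (exp_decay (n.+1 * i) x)%:E)%E.
Proof.
move=> kfin; under eq_integral do rewrite ray_testE -sumEFin.
rewrite integral_sum//=.
  apply: eq_bigr => i _; under eq_integral do rewrite EFinM.
  by rewrite integralZl//; exact: integrable_exp_decay.
move=> i; under [X in _.-integrable _ X]eq_fun do rewrite EFinM.
by apply: integrableZl => //; exact: integrable_exp_decay.
Qed.

Let cvg_integral_ray_test (k : {measure set mR -> \bar R}) a : 0 <= a ->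
  (k D < +oo)%E ->
  (\int[k]_(x in D) (ray_test a n x)%:E @[n --> \oo] --> k `]a, +oo[%classic)%E.
Proof.
move=> a0 kfin; have mray : measurable (`]a, +oo[%classic : set mR) by [].
have [||||||_ _] := @dominated_convergence _ mR R k D _
  (fun n x => (ray_test a n x)%:E) (EFin \o \1_(`]a, +oo[%classic))
  (* [exp_decay 0] is the constant 1. *)
  (EFin \o exp_decay 0).
- by [].
- move=> n; apply/measurable_EFinP; apply: measurable_funTS.
  exact: measurable_ray_test.
- by apply/measurable_EFinP; exact: measurable_funTS.
- apply: aeW => x; rewrite /= in_itv/= andbT => x0.
  by apply: cvg_EFin; [exact: nearW|exact: cvg_ray_test].
- exact: integrable_exp_decay.
- apply: aeW => x n; rewrite /= in_itv/= andbT => x0.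
  have /andP[t0 t1] := ray_test01 a n x0.
  by rewrite lee_fin ger0_norm// /exp_decay mul0r oppr0 expR0.
rewrite integral_indic// setIidl//.
by apply: subset_itv; rewrite ?bnd_simp.
Qed.

(** The integrals of the test functions only involve the given transforms, by the
    binomial formula; in the limit the two measures agree on open rays, and open
    rays are stable under intersection and generate the Borel sets. *)
Lemma finite_laplace_unique (k1 k2 : {measure set mR -> \bar R}) :
  k1 (~` D) = 0%E -> k2 (~` D) = 0%E -> (k1 D < +oo)%E ->
  (forall j : nat, \int[k1]_(x in D) (expR (- (j%:R * x)))%:E =
                   \int[k2]_(x in D) (expR (- (j%:R * x)))%:E)%E ->
  forall A : set mR, measurable A -> k1 A = k2 A.
Proof.
move=> k1N k2N k1fin k12.
have kD (k : {measure set mR -> \bar R}) :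
    k D = (\int[k]_(x in D) (expR (- (0%:R * x)))%:E)%E.
  under eq_integral do rewrite mul0r oppr0 expR0.
  by rewrite integral_cst// mul1e.
have k12D : k1 D = k2 D by rewrite !kD k12.
have k2fin : (k2 D < +oo)%E by rewrite -k12D.
have kT (k : {measure set mR -> \bar R}) (A : set mR) :
    measurable A -> k (~` D) = 0%E -> D `<=` A -> k A = k D.
  move=> mA kN DA; rewrite -(setDUK DA) measureU//; last 2 first.
  - exact: measurableD.
  - by rewrite setDIK.
  rewrite [X in (_ + X)%E](_ : _ = 0%E) ?adde0//.
  apply: (@subset_measure0 _ _ _ k _ (~` D)) => //.
  - exact: measurableD.
  - exact: measurableC.
move=> A; apply: (@measure_unique _ R mR (@RGenOInfty.G R)
  (fun n => `]- n%:R, +oo[%classic) _ _ _ _ k1 k2).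
- exact: RGenOInfty.measurableE.
- move=> _ _ [a ->] [b ->]; exists (Num.max a b).
  apply/seteqP; split => x /=; rewrite !in_itv/= !andbT gt_max.
    by move=> [-> ->].
  by move=> /andP[].
- by move=> n; exists (- n%:R).
- apply/seteqP; split => // x _; exists (Num.truncn `|x|).+1 => //=.
  by rewrite in_itv/= andbT ltrNl (le_lt_trans _ (truncnS_gt _))// ler_normr lexx orbT.
- move=> _ [a ->]; have [a0|a0] := leP 0 a.
    have h1 := cvg_integral_ray_test a0 k1fin.
    have h2 := cvg_integral_ray_test a0 k2fin.
    apply: cvg_unique h1 _ => //; apply: cvg_trans h2.
    apply: near_eq_cvg; apply: nearW => n.
    by rewrite !integral_ray_test//; apply: eq_bigr => i _; rewrite /exp_decay k12.
  have Da : D `<=` `]a, +oo[.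
    by move=> x /=; rewrite !in_itv/= !andbT; exact: lt_le_trans.
  by rewrite (kT k1)// (kT k2).
- move=> [|n].
    apply: le_lt_trans k1fin; rewrite oppr0; apply: le_measure; rewrite ?inE//.
    by apply: subset_itv; rewrite ?bnd_simp.
  rewrite (kT k1)// => x /=; rewrite !in_itv/= !andbT; apply: lt_le_trans.
  by rewrite oppr_lt0.
Qed.

End laplace_uniqueness.

Section laplace_uniqueness_functions.
Local Open Scope ereal_scope.
Context (R : realType).
Local Notation mR := (measurableTypeR R).
Local Notation D := (`[0%R, +oo[%classic : set mR).

Let measurable_exp_lin (c : R) :
  measurable_fun [set: mR] (fun x : R => expR (c * x)).
Proof. by apply: measurableT_comp => //; exact: measurable_funM. Qed.

Let measurable_exp_neg (c : R) :
  measurable_fun [set: mR] (fun x : R => expR (- (c * x))).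
Proof. by under eq_fun do rewrite -mulNr; exact: measurable_exp_lin. Qed.

(** The weight exp (- x) makes both measures finite and shifts the exponents by
    one, which reduces the claim to finite measures. *)
Lemma laplace_unique (k1 k2 : {measure set mR -> \bar R}) :
  k1 (~` D) = 0 -> k2 (~` D) = 0 ->
  \int[k1]_(x in D) (expR (- x))%:E < +oo ->
  (forall j : nat, \int[k1]_(x in D) (expR (- (j.+1%:R * x)))%:E =
                   \int[k2]_(x in D) (expR (- (j.+1%:R * x)))%:E) ->
  forall g : R -> \bar R, measurable_fun [set: mR] g -> (forall x, 0 <= g x) ->
  \int[k1]_x g x = \int[k2]_x g x.
Proof.
move=> k1N k2N k1fin k12.
have mw : measurable_fun [set: mR] (fun x : R => expR (- x)).
  by under eq_fun do rewrite -mulN1r; exact: measurable_exp_lin.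
have w0 (x : R) : (0 <= expR (- x))%R by exact: expR_ge0.
have [n1 n1E] := @density_measure_exists _ mR R k1 _ mw w0.
have [n2 n2E] := @density_measure_exists _ mR R k2 _ mw w0.
have mD : measurable D by [].
have mDC : measurable (~` D) by exact: measurableC.
have nN (k n : {measure set mR -> \bar R}) : k (~` D) = 0 ->
    (forall g : R -> \bar R, measurable_fun [set: mR] g ->
      (forall x, 0 <= g x) ->
      \int[n]_x g x = \int[k]_x (g x * (expR (- x))%:E)) -> n (~` D) = 0.
  move=> kN nE; rewrite -[X in n X]setIT -integral_indic//.
  rewrite nE//; last exact/measurable_EFinP.
  rewrite -[RHS](@integral_abs_eq0 _ mR R k (~` D)
    (fun x : R => (expR (- x))%:E)) //; last first.
    by apply/measurable_EFinP; exact: measurable_funTS.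
  rewrite [RHS]integral_mkcond; apply: eq_integral => x _.
  rewrite patchE indicE; case: ifPn => _; first by rewrite mul1e gee0_abs ?lee_fin.
  by rewrite mul0e.
have nD (k n : {measure set mR -> \bar R}) (j : nat) :
    (forall g : R -> \bar R, measurable_fun [set: mR] g ->
      (forall x, 0 <= g x) ->
      \int[n]_x g x = \int[k]_x (g x * (expR (- x))%:E)) ->
    \int[n]_(x in D) (expR (- (j%:R * x)))%:E =
    \int[k]_(x in D) (expR (- (j.+1%:R * x)))%:E.
  move=> nE; rewrite integral_mkcond nE.
  - rewrite [RHS]integral_mkcond; apply: eq_integral => x _.
    rewrite !patchE; case: ifPn => _; last by rewrite mul0e.
    by rewrite -EFinM -expRD -opprD -natr1 mulrDl mul1r.
  - apply/(measurable_restrictT _ mD); apply/measurable_EFinP.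
    by apply: measurable_funTS; exact: measurable_exp_neg.
  - by move=> x; rewrite patchE; case: ifPn => // _; rewrite lee_fin expR_ge0.
have n12 : forall A : set mR, measurable A -> n1 A = n2 A.
  apply: finite_laplace_unique; [exact: nN n1E|exact: nN n2E| |].
    have := nD _ _ 0%N n1E; under eq_integral do rewrite mul0r oppr0 expR0.
    rewrite integral_cst// mul1e => ->.
    by under eq_integral do rewrite mul1r.
  by move=> j; rewrite (nD _ _ j n1E) (nD _ _ j n2E) k12.
move=> g mg g0.
have mh : measurable_fun [set: mR] (fun x : R => g x * (expR x)%:E).
  by apply: emeasurable_funM => //; exact/measurable_EFinP.
have h0 (x : R) : 0 <= g x * (expR x)%:E by rewrite mule_ge0 ?lee_fin ?expR_ge0.
have gE (k n : {measure set mR -> \bar R}) :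
    (forall g : R -> \bar R, measurable_fun [set: mR] g ->
      (forall x, 0 <= g x) ->
      \int[n]_x g x = \int[k]_x (g x * (expR (- x))%:E)) ->
    \int[k]_x g x = \int[n]_x (g x * (expR x)%:E).
  move=> nE; rewrite nE//; apply: eq_integral => x _.
  by rewrite -muleA -EFinM expRxMexpNx_1 mule1.
rewrite (gE _ _ n1E) (gE _ _ n2E).
by apply: eq_measure_integral => A mA _; exact: n12.
Qed.

(** The form in which Laplace uniqueness is used: the weighted image of [m] along
    a nonnegative function lives on the half-line, and its Laplace transform is
    an integral with respect to [m]. *)
Lemma nonneg_image_exists d (T : measurableType d)
    (m : {measure set T -> \bar R}) (h : T -> mR) (w : T -> R) :
  measurable_fun [set: T] h -> measurable_fun [set: T] w ->
  (forall x, 0 <= h x)%R -> (forall x, 0 <= w x)%R ->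
  exists nu : {measure set mR -> \bar R},
  [/\ forall g : R -> \bar R, measurable_fun [set: mR] g ->
        (forall y, 0 <= g y) ->
        \int[nu]_y g y = \int[m]_x (g (h x) * (w x)%:E),
      nu (~` D) = 0 &
      forall t : R, \int[nu]_(y in D) (expR (- (t * y)))%:E =
                    \int[m]_x (expR (- (t * h x)) * w x)%:E].
Proof.
move=> mh mw h0 w0.
have [nu nuE] := weighted_image_exists m mh mw w0.
have mD : measurable D by [].
have mDC : measurable (~` D) by exact: measurableC.
exists nu; split=> //.
- rewrite -[X in nu X]setIT -integral_indic//.
  apply: (eq_trans (nuE (fun y => (\1_(~` D) y)%:E) _ _)).
  + exact/measurable_EFinP.
  + by move=> y; rewrite lee_fin.
  + apply: integral0_eq => x _; rewrite indicE memNset ?mul0e//=.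
    by rewrite in_itv/= andbT; apply; exact: h0.
- move=> t; rewrite [LHS]integral_mkcond.
  apply: (eq_trans (nuE ((fun y : mR => (expR (- (t * y)))%:E) \_ D) _ _)).
  + apply/(measurable_restrictT _ mD); apply/measurable_EFinP.
    by apply: measurable_funTS; exact: measurable_exp_neg.
  + by move=> x; rewrite patchE; case: ifPn => // _; rewrite lee_fin expR_ge0.
  + apply: eq_integral => x _; rewrite patchE mem_set//= in_itv/= andbT.
    exact: h0.
Qed.

End laplace_uniqueness_functions.

(** * Moments of the Gaussian and half-integer values of Gamma *)

Section gaussian_moments.
Context (R : realType).
Local Notation mu := (@lebesgue_measure R).

Definition gauss_weight (t : R) (p : nat) (r : R) : R :=
  r ^+ p * expR (- (t * r ^+ 2)).

Definition gauss_moment (t : R) (p : nat) : \bar R :=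
  (\int[mu]_(r in `[0%R, +oo[) (gauss_weight t p r)%:E)%E.

Lemma gauss_weight_ge0 t p r : 0 <= r -> 0 <= gauss_weight t p r.
Proof. by move=> r0; rewrite mulr_ge0 ?exprn_ge0 ?expR_ge0. Qed.

Lemma gauss_moment_ge0 t p : (0 <= gauss_moment t p)%E.
Proof.
apply: integral_ge0 => r; rewrite /= in_itv/= andbT => r0.
by rewrite lee_fin gauss_weight_ge0.
Qed.

Lemma continuous_gauss_weight t p : continuous (gauss_weight t p).
Proof.
move=> r; apply: cvgM; first exact: exprn_continuous.
apply: (@continuous_comp R R R (fun r : R => - (t * r ^+ 2)) expR).
  apply: cvgN; apply: cvgM; [exact: cvg_cst|exact: exprn_continuous].
exact: continuous_expR.
Qed.

Lemma measurable_gauss_weight t p : measurable_fun [set: R] (gauss_weight t p).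
Proof. apply: continuous_measurable_fun; exact: continuous_gauss_weight. Qed.

Lemma cvg_gauss_moment t p :
  (\int[mu]_(r in `[0%R, n.+1%:R]) (gauss_weight t p r)%:E @[n --> \oo]
    --> gauss_moment t p)%E.
Proof.
rewrite /gauss_moment itv0y_bigcup0S; apply: ge0_nondecreasing_set_cvg_integral.
- apply/nondecreasing_seqP => n; rewrite subsetEset.
  by apply: subset_itvl; rewrite bnd_simp ler_nat.
- by [].
- move=> n; apply/measurable_EFinP; apply: measurable_funTS.
  exact: measurable_gauss_weight.
- move=> n r; rewrite /= in_itv/= => /andP[r0 _].
  by rewrite lee_fin gauss_weight_ge0.
Qed.

Let gauss_primitive (t : R) (r : R) : R := - (2 * t)^-1 * expR (- (t * r ^+ 2)).

Let is_derive_gauss_primitive t (r : R) : t != 0 ->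
  is_derive r 1 (gauss_primitive t) (gauss_weight t 1 r).
Proof.
move=> t0; rewrite /gauss_primitive.
have h : is_derive r 1 (fun r : R => - (t * r ^+ 2)) (- (2 * t * r)).
  by apply: is_derive_eq; rewrite /GRing.scale/=; ring.
have he := @is_derive1_comp R expR (fun r : R => - (t * r ^+ 2)) r _ _
  (is_derive_expR _) h.
apply: (@is_derive_eq _ _ _ _ _ _ _ _
  (@is_deriveZ _ _ _ _ (- (2 * t)^-1) _ _ _ he)).
by rewrite /GRing.scale/= /gauss_weight; field.
Qed.

Let continuous_gauss_primitive t : continuous (gauss_primitive t).
Proof.
move=> r; rewrite /gauss_primitive.
apply: cvgM; first exact: cvg_cst.
apply: (@continuous_comp R R R (fun r : R => - (t * r ^+ 2)) expR).
  apply: cvgN; apply: cvgM; [exact: cvg_cst|exact: exprn_continuous].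
exact: continuous_expR.
Qed.

Let cvg_gauss_primitive0 t p : 0 < t ->
  n.+1%:R ^+ p * gauss_primitive t n.+1%:R @[n --> \oo] --> (0 : R).
Proof.
move=> t0; pose C := (2 * t)^-1 * (p.+1`!%:R / t ^+ p.+1).
have C0 : 0 <= C by rewrite mulr_ge0 ?divr_ge0 ?invr_ge0 ?exprn_ge0 ?mulr_ge0 ?ltW.
apply: (@squeeze_cvgr _ _ _ R (fun n => - (C * harmonic n)) (fun=> 0)).
- apply: nearW => n; have c0 : 0 < n.+1%:R :> R by rewrite ltr0n.
  rewrite /gauss_primitive /harmonic/= mulNr mulrN oppr_le0 lerN2.
  rewrite !mulr_ge0 ?invr_ge0 ?exprn_ge0 ?expR_ge0 ?mulr_ge0 ?(ltW t0)//= ?andbT.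
  rewrite mulrCA /C -[leRHS]mulrA ler_pM2l ?invr_gt0 ?mulr_gt0//.
  have e1 : (t * n.+1%:R ^+ 2) ^+ p.+1 / p.+1`!%:R <= expR (t * n.+1%:R ^+ 2).
    have x0 : 0 <= t * n.+1%:R ^+ 2 by rewrite mulr_ge0 ?exprn_ge0 ?ltW.
    by apply: le_trans (expR_ge1Dxn p x0); rewrite lerDr.
  (* The square in the exponent is weakened to a first power so that the power
     p + 1 of n beats n^p by exactly one factor. *)
  have e2 : (t * n.+1%:R) ^+ p.+1 / p.+1`!%:R <= expR (t * n.+1%:R ^+ 2).
    apply: le_trans e1; rewrite ler_pM2r ?invr_gt0 ?ltr0n ?fact_gt0//.
    rewrite lerXn2r ?nnegrE ?mulr_ge0 ?exprn_ge0 ?(ltW t0)// ler_pM2l// expr2.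
    by rewrite ler_peMr ?ler1n.
  rewrite expRN ler_pdivrMr ?expR_gt0//; apply: le_trans (ler_wpM2l _ e2).
    rewrite exprMn exprS [_ ^+ p.+1 in X in _ <= _ * (_ * X / _)]exprS.
    rewrite le_eqVlt; apply/orP; left; apply/eqP; field.
    by rewrite !gt_eqF ?exprn_gt0// ltr0n fact_gt0.
  by rewrite mulr_ge0 ?divr_ge0 ?invr_ge0 ?exprn_ge0// ltW.
- rewrite -[X in _ --> X]oppr0; apply: cvgN; rewrite -[X in _ --> X](mulr0 C).
  by apply: cvgM; [exact: cvg_cst|exact: cvg_harmonic].
- exact: cvg_cst.
Qed.

(** Integration by parts against the primitive - exp (- t r^2) / 2t of
    r exp (- t r^2). *)
Lemma gauss_moment_rec t p : 0 < t ->
  gauss_moment t p.+2 = ((p.+1%:R / (2 * t))%:E * gauss_moment t p)%E.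
Proof.
move=> t0; have tn0 : t != 0 by rewrite gt_eqF.
suff cvgr : (\int[mu]_(r in `[0%R, n.+1%:R]) (gauss_weight t p.+2 r)%:E
    @[n --> \oo] --> (p.+1%:R / (2 * t))%:E * gauss_moment t p)%E.
  exact: cvg_unique (@cvg_gauss_moment t p.+2) cvgr.
have parts n : (\int[mu]_(r in `[0%R, n.+1%:R]) (gauss_weight t p.+2 r)%:E =
    (n.+1%:R ^+ p.+1 * gauss_primitive t n.+1%:R)%:E + (p.+1%:R / (2 * t))%:E *
    \int[mu]_(r in `[0%R, n.+1%:R]) (gauss_weight t p r)%:E)%E.
  have := @integration_by_parts R (fun r => r ^+ p.+1) (gauss_primitive t)
    (fun r => p.+1%:R * r ^+ p) (gauss_weight t 1) 0 n.+1%:R.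
  have cF : continuous (fun r : R => r ^+ p.+1) by exact: exprn_continuous.
  have cG : continuous (gauss_primitive t) by exact: continuous_gauss_primitive.
  rewrite expr0n/= mul0r subr0 => parts.
  under eq_integral.
    move=> r _; rewrite (_ : gauss_weight t p.+2 r =
      r ^+ p.+1 * gauss_weight t 1 r); last first.
      by rewrite /gauss_weight expr1 exprSr mulrA.
    over.
  rewrite parts//.
  - have w0 r : `[0, n.+1%:R]%classic r -> (0 <= (gauss_weight t p r)%:E)%E.
      by rewrite /= in_itv/= => /andP[r0 _]; rewrite lee_fin gauss_weight_ge0.
    have c0 : 0 <= p.+1%:R / (2 * t) by rewrite divr_ge0// mulr_ge0// ltW.
    congr (_ + _)%E; rewrite -ge0_integralZl_EFin//; last first.
      apply/measurable_EFinP/measurable_funTS; exact: measurable_gauss_weight.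
    rewrite -[RHS]oppeK; congr (- _)%E; rewrite -integral_ge0N; last first.
      by move=> r r0; apply: mule_ge0; [rewrite lee_fin|exact: w0].
    apply: eq_integral => r _; rewrite -EFinM -EFinN; congr EFin.
    by rewrite /gauss_weight /gauss_primitive; field.
  - apply: continuous_subspaceT => r; apply: cvgM; first exact: cvg_cst.
    exact: exprn_continuous.
  - split=> [r _||]; first exact: exprn_derivable.
      by apply: cvg_at_right_filter; exact: cF.
    by apply: cvg_at_left_filter; exact: cF.
  - by move=> r _; rewrite derive1E exp_derive /GRing.scale/= mulr1.
  - by apply: continuous_subspaceT; exact: continuous_gauss_weight.
  - split=> [r _||].
    + exact: (@ex_derive _ _ _ _ _ _ _ (is_derive_gauss_primitive r tn0)).
    + by apply: cvg_at_right_filter; exact: cG.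
    + by apply: cvg_at_left_filter; exact: cG.
  - move=> r _; rewrite derive1E.
    exact: (@derive_val _ _ _ _ _ _ _ (is_derive_gauss_primitive r tn0)).
rewrite (funext parts).
rewrite -[X in _ --> X]add0e; apply: cvgeD.
- rewrite ge0_adde_def// inE// mule_ge0 ?gauss_moment_ge0// lee_fin divr_ge0//.
  by rewrite mulr_ge0// ltW.
- by apply: cvg_EFin; [exact: nearW|exact: cvg_gauss_primitive0].
- by apply: cvgeZl => //; exact: cvg_gauss_moment.
Qed.
End gaussian_moments.

Section gamma_half_integers.
Context (R : realType).
Local Notation mu := (@lebesgue_measure R).

Let gamma_weight (z u : R) : R := u `^ (z - 1) * expR (- u).

Let continuous_gamma_weight z (u : R) : 0 < u -> {for u, continuous (gamma_weight z)}.
Proof.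
move=> u0; apply: (@continuousM R R); last first.
  by apply: continuous_comp; [exact: continuousN|exact: continuous_expR].
apply: differentiable_continuous; apply/derivable1_diffP.
by apply: derivable_powR; rewrite in_itv/= u0.
Qed.

Let measurable_gamma_weight z : measurable_fun (`]0%R, +oo[%classic : set R) (gamma_weight z).
Proof.
apply: open_continuous_measurable_fun; first exact: interval_open.
by move=> u; rewrite inE/= in_itv/= andbT; exact: continuous_gamma_weight.
Qed.

Let bigcup_itv_harmonic (t : R) : 0 < t ->
  \bigcup_n `[t * n.+1%:R^-1 ^+ 2, t * n.+1%:R ^+ 2]%classic = `]0, +oo[%classic.
Proof.
move=> t0; apply/seteqP; split=> [x [n _]|x] /=; rewrite !in_itv/= ?andbT.
  by move=> /andP[+ _]; apply: lt_le_trans; rewrite mulr_gt0 ?exprn_gt0.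
move=> x0; pose m := Num.truncn (Num.max (x / t) (t / x)).
have : Num.max (x / t) (t / x) <= m.+1%:R by exact/ltW/truncnS_gt.
rewrite ge_max ler_pdivrMr// ler_pdivrMr// => /andP[xm tm].
have m1 : m.+1%:R <= m.+1%:R ^+ 2 :> R by rewrite expr2 ler_peMr ?ler1n.
exists m => //=; rewrite in_itv/=; apply/andP; split; last first.
  by rewrite (le_trans xm)// mulrC ler_pM2l.
rewrite exprVn ler_pdivrMr ?exprn_gt0// (le_trans tm)// mulrC ler_pM2l//.
Qed.

(** The change of variables u = t r^2 in Euler's integral. It is made on the
    compact intervals [1/n, n] because the integrand in u may be singular at 0,
    and both sides are then exhausted by monotone convergence. *)
Lemma integral_gamma_weight (t : R) p : 0 < t ->
  (\int[mu]_(u in `]0%R, +oo[) (u `^ (p.+1%:R / 2 - 1) * expR (- u))%:E =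
   (2 * t `^ (p.+1%:R / 2))%:E * gauss_moment t p)%E.
Proof.
move=> t0; set z := p.+1%:R / 2; under eq_integral do rewrite -/(gamma_weight z _).
pose a (n : nat) : R := n.+1%:R^-1; pose b (n : nat) : R := n.+1%:R.
have a0 n : 0 < a n by rewrite invr_gt0.
have ab n : a n <= b n.
  by rewrite (@le_trans _ _ 1)// ?invf_le1 ?ler1n.
have and1 m n : (m <= n)%N -> a n <= a m.
  by move=> mn; rewrite lef_pV2 ?posrE// ler_nat.
have mgw (D : set R) : measurable_fun D (gauss_weight t p).
  by apply: measurable_funTS; exact: measurable_gauss_weight.
pose F (r : R) := t * r ^+ 2.
have dF (r : R) : is_derive r 1 F (2 * t * r).
  by apply: is_derive_eq; rewrite /GRing.scale/=; ring.
have F'E : (derive1 F) = (fun r => 2 * t * r).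
  by apply/funext => r; rewrite derive1E; exact: derive_val.
have cF : continuous F.
  by move=> r; apply: cvgM; [exact: cvg_cst|exact: exprn_continuous].
have cF' : continuous (derive1 F).
  by rewrite F'E => r; apply: cvgM; [exact: cvg_cst|exact: cvg_id].
have Fpos r : 0 < r -> 0 < F r by move=> r0; rewrite mulr_gt0 ?exprn_gt0.
have subst n : (\int[mu]_(u in `[F (a n), F (b n)]) (gamma_weight z u)%:E =
   \int[mu]_(r in `[a n, b n]) (2 * t `^ z * gauss_weight t p r)%:E)%E.
  rewrite integration_by_substitution_increasing//.
  - apply: eq_integral => r; rewrite inE/= in_itv/= => /andP[ar _].
    have r0 : 0 < r by exact: lt_le_trans ar.
    have rn0 : r != 0 by rewrite gt_eqF.
    congr EFin; rewrite F'E /gamma_weight /gauss_weight fctE/= /F.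
    rewrite powRM ?exprn_ge0 ?(ltW t0) ?(ltW r0)//.
    rewrite -(powR_mulrn 2 (ltW r0)) -powRrM.
    have -> : r ^+ p = r `^ (2 * (z - 1)) * r.
      rewrite -{3}(powRr1 (ltW r0)) -powRD ?rn0 ?implybT//.
      by rewrite -powR_mulrn ?(ltW r0)//; congr powR; rewrite /z -natr1; field.
    have -> : t `^ z = t `^ (z - 1) * t.
      rewrite -{3}(powRr1 (ltW t0)) -powRD ?(gt_eqF t0) ?implybT//.
      by rewrite subrK.
    by ring.
  - move=> r s; rewrite !in_itv/= => /andP[ar _] /andP[As _] rs.
    have r0 : 0 <= r by exact: le_trans (ltW (a0 n)) ar.
    have s0 : 0 <= s by exact: le_trans (ltW (a0 n)) As.
    by rewrite /F ltr_pM2l// ltrXn2r.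
  - by apply/cvg_ex; exists ((derive1 F) (a n)); apply: cvg_at_right_filter; exact: cF'.
  - by apply/cvg_ex; exists ((derive1 F) (b n)); apply: cvg_at_left_filter; exact: cF'.
  - split=> [r _||].
    + exact: ex_derive.
    + by apply: cvg_at_right_filter; exact: cF.
    + by apply: cvg_at_left_filter; exact: cF.
  - apply: continuous_in_subspaceT => u; rewrite inE/= in_itv/= => /andP[Fu _].
    by apply: continuous_gamma_weight; rewrite (lt_le_trans _ Fu)// Fpos.
have cvgL : (\int[mu]_(u in `[F (a n), F (b n)]) (gamma_weight z u)%:E @[n --> \oo]
    --> \int[mu]_(u in `]0%R, +oo[) (gamma_weight z u)%:E)%E.
  have -> : `]0%R, +oo[%classic = \bigcup_n `[F (a n), F (b n)]%classic.
    by rewrite -(bigcup_itv_harmonic t0).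
  apply: ge0_nondecreasing_set_cvg_integral.
  - move=> m n mn; rewrite subsetEset; apply: subset_itv; rewrite bnd_simp.
      by rewrite /F ler_pM2l// lerXn2r ?nnegrE ?(ltW (a0 _))// and1.
    by rewrite /F ler_pM2l// lerXn2r ?nnegrE// ler_nat.
  - by [].
  - move=> n; apply/measurable_EFinP.
    apply: measurable_funS (measurable_gamma_weight z) => // u.
    by rewrite /= !in_itv/= andbT => /andP[+ _]; apply: lt_le_trans; exact: Fpos.
  - by move=> n u _; rewrite lee_fin mulr_ge0 ?powR_ge0 ?expR_ge0.
have cvgR : (\int[mu]_(r in `[a n, b n]) (2 * t `^ z * gauss_weight t p r)%:E
    @[n --> \oo] --> (2 * t `^ z)%:E * gauss_moment t p)%E.
  have c0 : 0 <= 2 * t `^ z by rewrite mulr_ge0 ?powR_ge0.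
  have -> : ((2 * t `^ z)%:E * gauss_moment t p)%E =
      (\int[mu]_(r in `]0%R, +oo[) (2 * t `^ z * gauss_weight t p r)%:E)%E.
    rewrite integral_itv_obnd_cbnd; last exact/measurable_EFinP/measurable_funM.
    rewrite /gauss_moment -ge0_integralZl_EFin//; last 2 first.
    - move=> r; rewrite /= in_itv/= andbT => r0.
      by rewrite lee_fin gauss_weight_ge0.
    - apply/measurable_EFinP; exact: mgw.
  have -> : `]0%R, +oo[%classic = \bigcup_n `[a n, b n]%classic :> set R.
    rewrite -(bigcup_itv_harmonic ltr01); apply/seteqP; split=> x [n _].
      rewrite /= in_itv/= !mul1r => /andP[h1 h2].
      have [m mE] : exists m, m.+1%:R = n.+1%:R ^+ 2 :> R.
        by exists (n.+1 ^ 2).-1%N; rewrite prednK ?expn_gt0// natrX.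
      by exists m => //=; rewrite in_itv/= /a /b mE -exprVn h1 h2.
    rewrite /= in_itv/= => /andP[h1 h2]; exists n => //=.
    rewrite in_itv/= !mul1r; apply/andP; split.
      rewrite (le_trans _ h1)// expr2 ler_piMr ?invr_ge0// invf_le1 ?ler1n//.
    by rewrite (le_trans h2)// expr2 ler_peMr ?ler1n.
  apply: ge0_nondecreasing_set_cvg_integral.
  - move=> m n mn; rewrite subsetEset; apply: subset_itv; rewrite bnd_simp.
      exact: and1.
    by rewrite ler_nat.
  - by [].
  - move=> n; apply/measurable_EFinP/measurable_funM => //.
    exact: mgw.
  - move=> n r; rewrite /= in_itv/= => /andP[ar _].
    rewrite lee_fin mulr_ge0// gauss_weight_ge0//.
    exact: ltW (lt_le_trans (a0 n) ar).
by apply: cvg_unique cvgL _ => //; rewrite (funext subst).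
Qed.
End gamma_half_integers.

Section gamma_half_integer_values.
Context (R : realType).
Local Notation mu := (@lebesgue_measure R).

Let gauss_weight1 (p : nat) (r : R) : gauss_weight 1 p r = r ^+ p * gauss_fun r.
Proof. by rewrite /gauss_weight mul1r. Qed.

Lemma gauss_moment10 : gauss_moment (1 : R) 0 = (Num.sqrt pi / 2)%:E.
Proof.
rewrite /gauss_moment -integral0y_gauss; apply: eq_integral => r _.
by rewrite gauss_weight1 expr0 mul1r.
Qed.

Lemma gauss_moment11 : gauss_moment (1 : R) 1 = (2^-1)%:E.
Proof.
pose F (r : R) : R := - 2^-1 * gauss_fun r.
have cF : continuous F.
  by move=> r; apply: cvgM; [exact: cvg_cst|exact: continuous_gauss_fun].
have dF (r : R) : is_derive r (1 : R) F (gauss_weight 1 1 r).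
  have h : is_derive r 1 (fun r : R => - r ^+ 2) (- (2 * r)).
    by apply: is_derive_eq; rewrite /GRing.scale/=; ring.
  have he := @is_derive1_comp R expR (fun r : R => - r ^+ 2) r _ _
    (is_derive_expR _) h.
  apply: (@is_derive_eq _ _ _ _ _ _ _ _
    (@is_deriveZ _ _ _ _ (- 2^-1) _ _ _ he)).
  by rewrite /GRing.scale/= gauss_weight1 /gauss_fun; field.
rewrite /gauss_moment (@ge0_continuous_FTC2y _ _ F _ 0).
- by rewrite -EFinB /F /gauss_fun expr0n/= oppr0 expR0; congr EFin; ring.
- by move=> r r0; exact: gauss_weight_ge0.
- by apply: continuous_subspaceT; exact: continuous_gauss_weight.
- rewrite -[X in _ --> X](mulr0 (- 2^-1)).
  by apply: cvgM; [exact: cvg_cst|exact: cvg_gauss_fun].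
- by move=> r _; exact: (@ex_derive _ _ _ _ _ _ _ (dF r)).
- by apply: cvg_at_right_filter; exact: cF.
- by move=> r _; rewrite derive1E; exact: (@derive_val _ _ _ _ _ _ _ (dF r)).
Qed.

(* The recurrence relates moments two steps apart, so the induction carries two
   consecutive ones, starting from the Gaussian integral and from 1/2. *)
Let gauss_moment1_fin_gt0 p :
  (gauss_moment (1 : R) p \is a fin_num) /\ (0 < gauss_moment (1 : R) p)%E.
Proof.
suff [] : (gauss_moment (1 : R) p \is a fin_num /\
    (0 < gauss_moment (1 : R) p)%E) /\
  (gauss_moment (1 : R) p.+1 \is a fin_num /\
    (0 < gauss_moment (1 : R) p.+1)%E) by [].
elim: p => [|p [IH IH1]].
  by rewrite gauss_moment10 gauss_moment11 !lte_fin divr_gt0 ?sqrtr_gt0 ?pi_gt0.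
split=> //; rewrite gauss_moment_rec//; case: IH => fin pos.
by rewrite fin_numM// mule_gt0// lte_fin divr_gt0.
Qed.

Let GammaE p :
  (Gamma (p.+1%:R / 2 : R))%:E = (2%:E * gauss_moment (1 : R) p)%E.
Proof.
rewrite /Gamma /Rintegral (integral_gamma_weight p (@ltr01 R)) powR1 mulr1 fineK//.
by rewrite fin_numM// (gauss_moment1_fin_gt0 p).1.
Qed.

Lemma Gamma_half_gt0 p : 0 < Gamma (p.+1%:R / 2 : R).
Proof.
by rewrite -lte_fin GammaE mule_gt0// (gauss_moment1_fin_gt0 p).2.
Qed.

Lemma Gamma_half : Gamma (2^-1 : R) = Num.sqrt pi.
Proof.
apply: EFin_inj; rewrite -[2^-1]mul1r (GammaE 0) gauss_moment10 -EFinM.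
by congr EFin; field.
Qed.

Lemma Gamma_half_rec p :
  Gamma (p.+3%:R / 2 : R) = p.+1%:R / 2 * Gamma (p.+1%:R / 2 : R).
Proof.
apply: EFin_inj; rewrite EFinM !GammaE gauss_moment_rec// mulr1.
by rewrite muleCA.
Qed.

Lemma gauss_momentE (t : R) p : 0 < t ->
  gauss_moment t p =
  (Gamma (p.+1%:R / 2) / (2 * t `^ (p.+1%:R / 2)))%:E.
Proof.
move=> t0; have c0 : 0 < 2 * t `^ (p.+1%:R / 2) by rewrite mulr_gt0// powR_gt0.
have := integral_gamma_weight p t0.
have := integral_gamma_weight p (@ltr01 R); rewrite powR1 mulr1 => -> e.
by rewrite mulrC EFinM GammaE e muleA -EFinM mulVf ?mul1e ?gt_eqF.
Qed.

End gamma_half_integer_values.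

(** * The spherical average of the cosine *)

Section radial_cosine.
Context (R : realType).

(** Equal to 4^m m! (d/2)_m, with a rising factorial; for d = 1 this is
    (2 m)!, see [radial_fact1]. *)
Definition radial_fact (d m : nat) : nat :=
  \prod_(i < m) ((2 * i.+1) * (2 * i + d)).

Definition radial_cos_coeff (d : nat) (z : R) (m : nat) : R :=
  (-1) ^+ m * (z ^+ (2 * m) / (radial_fact d m)%:R).

(** Omega_d (z) = Gamma(d/2) (2/z)^nu J_nu(z) with nu = (d-2)/2: the mean of
    cos (z u_1) over the unit sphere of R^d, and the cosine itself for d = 1. Its
    coefficients are rational, so that Gamma only enters when it is compared
    with J_nu. *)
Definition radial_cos (d : nat) (z : R) : R :=
  limn (series (radial_cos_coeff d z)).

Lemma radial_factS d m :
  radial_fact d m.+1 = (radial_fact d m * ((2 * m.+1) * (2 * m + d)))%N.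
Proof. exact: big_ord_recr. Qed.

Lemma radial_fact_gt0 d m : (0 < d)%N -> (0 < radial_fact d m)%N.
Proof.
by move=> d0; apply: prodn_gt0 => i; rewrite !muln_gt0/= addn_gt0 d0 orbT.
Qed.

Lemma fact_le_radial_fact d m : (0 < d)%N -> (m`! <= radial_fact d m)%N.
Proof.
move=> d0; elim: m => [|m IH]; first by rewrite /radial_fact big_ord0.
rewrite factS radial_factS mulnC leq_mul//.
by rewrite -[X in (X <= _)%N]muln1 leq_mul ?leq_pmull// addn_gt0 d0 orbT.
Qed.

Lemma radial_fact1 m : radial_fact 1 m = ((2 * m)`!)%N.
Proof.
elim: m => [|m IH]; first by rewrite /radial_fact big_ord0.
by rewrite radial_factS IH mulnS !factS; ring.
Qed.

Lemma norm_radial_cos_coeff d z m : (0 < d)%N ->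
  `|radial_cos_coeff d z m| <= exp_coeff (z ^+ 2) m.
Proof.
move=> d0; rewrite /radial_cos_coeff /exp_coeff/= normrM normrX normrN1 expr1n.
rewrite mul1r exprM ger0_norm; last by rewrite mulr_ge0// exprn_ge0// sqr_ge0.
apply: ler_wpM2l; first by rewrite exprn_ge0 ?sqr_ge0.
by rewrite lef_pV2 ?posrE ?ltr0n ?fact_gt0 ?radial_fact_gt0// ler_nat fact_le_radial_fact.
Qed.

Lemma cvg_radial_cos d z : (0 < d)%N ->
  series (radial_cos_coeff d z) @ \oo --> radial_cos d z.
Proof.
move=> d0; apply: normed_cvg.
apply: (@series_le_cvg _ _ (exp_coeff (z ^+ 2))).
- by move=> n; exact: normr_ge0.
- by move=> n; rewrite exp_coeff_ge0 ?sqr_ge0.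
- by move=> n; exact: norm_radial_cos_coeff.
- exact: is_cvg_series_exp_coeff.
Qed.

(** The terms of index at least 1 are dominated by those of exp (z^2). *)
Lemma radial_cos_near1 d z : (0 < d)%N ->
  `|radial_cos d z - 1| <= expR (z ^+ 2) - 1.
Proof.
move=> d0.
have c0 : radial_cos_coeff d z 0 = 1.
  by rewrite /radial_cos_coeff /radial_fact big_ord0 !expr0 !mul1r invr1.
have e0 : exp_coeff (z ^+ 2) 0%N = 1 by rewrite /exp_coeff/= expr0 fact0 divr1.
have partial n : `|series (radial_cos_coeff d z) n.+1 - 1| <=
    series (exp_coeff (z ^+ 2)) n.+1 - 1.
  rewrite /series/= !big_nat_recl//= c0 e0 !(addrC 1) !addrK.
  rewrite (le_trans (ler_norm_sum _ _ _))//.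
  by apply: ler_sum => i _; exact: norm_radial_cos_coeff.
have h1 : `|series (radial_cos_coeff d z) n.+1 - 1| @[n --> \oo] -->
    `|radial_cos d z - 1|.
  apply: cvg_norm; apply: cvgB; last exact: cvg_cst.
  by rewrite (@cvg_shiftS _ (series (radial_cos_coeff d z))); exact: cvg_radial_cos.
have h2 : series (exp_coeff (z ^+ 2)) n.+1 - 1 @[n --> \oo] -->
    expR (z ^+ 2) - 1.
  apply: cvgB; last exact: cvg_cst.
  by rewrite (@cvg_shiftS _ (series (exp_coeff (z ^+ 2)))); exact: is_cvg_series_exp_coeff.
by apply: ler_cvg_to h1 h2 _; exact: nearW.
Qed.

Lemma radial_cos1 z : radial_cos 1 z = cos z.
Proof.
rewrite /radial_cos (_ : radial_cos_coeff 1 z = cos_coeff' z).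
  by apply/cvg_lim => //; exact: cvg_cos_coeff'.
apply/funext => i.
by rewrite /radial_cos_coeff /cos_coeff' radial_fact1 -mul2n mulrA.
Qed.

Lemma measurable_radial_cos d k : (0 < d)%N ->
  measurable_fun [set: R] (fun r => radial_cos d (k * r)).
Proof.
move=> d0; apply: (@measurable_fun_cvg _ _ _ _
  (fun n r => series (radial_cos_coeff d (k * r)) n)).
  move=> n; apply: measurable_sum => i; apply: measurable_funM => //.
  by apply: measurable_funM => //; apply: measurable_funX; exact: measurable_funM.
by move=> r _; exact: cvg_radial_cos.
Qed.

End radial_cosine.

(** * Gaussian transform of the spherical average *)

Section gaussian_transform.
Context (R : realType).
Local Notation mu := (@lebesgue_measure R).
Local Notation pos := (`[0%R, +oo[%classic : set R).

Lemma gauss_moment_fin_num (t : R) p : 0 < t -> gauss_moment t p \is a fin_num.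
Proof. by move=> t0; rewrite gauss_momentE. Qed.

(* The denominators 2 (i + 1) (2 i + d) of the series contain exactly the factors
   2 i + d produced by the moment recurrence; what remains is exp. *)
Let gauss_moment_radial (t k : R) n m : 0 < t ->
  ((k ^+ (2 * m) / (radial_fact n.+1 m)%:R)%:E * gauss_moment t (n + 2 * m) =
   (exp_coeff (k ^+ 2 / (4 * t)) m)%:E * gauss_moment t n)%E.
Proof.
move=> t0; have tn0 : t != 0 by rewrite gt_eqF.
elim: m => [|m IH].
  rewrite muln0 addn0 /radial_fact big_ord0 /exp_coeff/= !expr0 fact0.
  by rewrite !divr1.
rewrite mulnS addnA addnAC addn2 gauss_moment_rec// muleA -EFinM.
rewrite radial_factS.
have Pn0 : (radial_fact n.+1 m)%:R != 0 :> R.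
  by rewrite pnatr_eq0 -lt0n radial_fact_gt0.
have m1n0 : m%:R + 1 != 0 :> R by rewrite natr1 pnatr_eq0.
transitivity ((k ^+ 2 / (4 * t) / m.+1%:R)%:E *
    ((k ^+ (2 * m) / (radial_fact n.+1 m)%:R)%:E * gauss_moment t (n + 2 * m)))%E.
  rewrite muleA -EFinM; congr ((_)%:E * _)%E.
  move: (radial_fact n.+1 m) Pn0 => P Pn0.
  rewrite exprD -[(n + 2 * m).+1]addn1 -[n.+1]addn1 -[m.+1]addn1.
  rewrite !(natrM, natrD); field; rewrite Pn0 m1n0 tn0/=.
  by rewrite -natrM !natr1 -natrD pnatr_eq0 addnS.
rewrite IH muleA -EFinM; congr ((_)%:E * _)%E.
rewrite /exp_coeff/= factS natrM (exprS (k ^+ 2 / (4 * t))).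
move: (_ ^+ m) => X.
have f0 : m`!%:R != 0 :> R by rewrite pnatr_eq0 -lt0n fact_gt0.
by field; rewrite f0 addrC m1n0 tn0.
Qed.

Let term (t k : R) n m (r : R) : R :=
  gauss_weight t n r * radial_cos_coeff n.+1 (k * r) m.

Let coef (k : R) n m : R := k ^+ (2 * m) / (radial_fact n.+1 m)%:R.

Let coef_ge0 k n m : 0 <= coef k n m.
Proof. by rewrite mulr_ge0// exprM exprn_ge0// sqr_ge0. Qed.

Let termE t k n m r :
  term t k n m r = (-1) ^+ m * coef k n m * gauss_weight t (n + 2 * m) r.
Proof.
by rewrite /term /coef /radial_cos_coeff /gauss_weight exprMn exprD; ring.
Qed.

Let normr_term t k n m r : 0 <= r ->
  `|term t k n m r| = coef k n m * gauss_weight t (n + 2 * m) r.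
Proof.
move=> r0; rewrite termE normrM normrM normrX normrN1 expr1n mul1r.
by rewrite !ger0_norm ?gauss_weight_ge0 ?coef_ge0.
Qed.

Let measurable_term t k n m : measurable_fun pos (term t k n m).
Proof.
apply: measurable_funTS; rewrite (_ : term _ _ _ _ = fun r =>
  (-1) ^+ m * coef k n m * gauss_weight t (n + 2 * m) r); last first.
  by apply/funext => r; exact: termE.
by apply: measurable_funM => //; exact: measurable_gauss_weight.
Qed.

Lemma integrable_gauss_weight t p : 0 < t ->
  mu.-integrable pos (EFin \o gauss_weight t p).
Proof.
move=> t0; apply/integrableP; split.
  by apply/measurable_EFinP/measurable_funTS; exact: measurable_gauss_weight.
rewrite (_ : (\int[mu]_(r in pos) _)%E = gauss_moment t p).
  have := gauss_moment_fin_num p t0.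
  by rewrite ge0_fin_numE ?gauss_moment_ge0.
apply: eq_integral => r; rewrite inE/= in_itv/= andbT => r0.
by rewrite ger0_norm// gauss_weight_ge0.
Qed.

Let integral_norm_term t k n m : 0 < t ->
  (\int[mu]_(r in pos) `|(term t k n m r)%:E| =
   (exp_coeff (k ^+ 2 / (4 * t)) m)%:E * gauss_moment t n)%E.
Proof.
move=> t0; rewrite -gauss_moment_radial//.
have w0 r : pos r -> (0 <= (gauss_weight t (n + 2 * m) r)%:E)%E.
  by rewrite /= in_itv/= andbT => r0; rewrite lee_fin gauss_weight_ge0.
have mw : measurable_fun pos (fun r => (gauss_weight t (n + 2 * m) r)%:E).
  by apply/measurable_EFinP/measurable_funTS; exact: measurable_gauss_weight.
rewrite -ge0_integralZl_EFin//; last exact: coef_ge0.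
apply: eq_integral => r; rewrite inE/= in_itv/= andbT => r0.
by rewrite normr_term// EFinM.
Qed.

Let integral_term t k n m : 0 < t ->
  (\int[mu]_(r in pos) (term t k n m r)%:E =
   (exp_coeff (- (k ^+ 2 / (4 * t))) m)%:E * gauss_moment t n)%E.
Proof.
move=> t0; under eq_integral do rewrite termE EFinM.
rewrite integralZl//; last exact: integrable_gauss_weight.
rewrite -/(gauss_moment t _) EFinM -muleA gauss_moment_radial// muleA -EFinM.
by congr ((_)%:E * _)%E; rewrite /exp_coeff/= [in RHS]exprNn mulrA.
Qed.

(** Term by term integration; the partial sums are dominated by the series of
    absolute values, whose integral is the moment times exp (k^2 / 4t) by
    Tonelli. *)
Lemma integral_gauss_radial_cos (t k : R) n : 0 < t ->
  mu.-integrable pos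
    (EFin \o (fun r => gauss_weight t n r * radial_cos n.+1 (k * r))) /\
  (\int[mu]_(r in pos) (gauss_weight t n r * radial_cos n.+1 (k * r))%:E =
   gauss_moment t n * (expR (- (k ^+ 2 / (4 * t))))%:E)%E.
Proof.
move=> t0.
pose f_ N r := (\sum_(m < N) term t k n m r)%:E.
pose g r := (\sum_(m <oo) `|(term t k n m r)%:E|)%E.
have mnt m : measurable_fun pos (fun r => `|(term t k n m r)%:E|%E).
  by apply: measurableT_comp => //; apply/measurable_EFinP.
have mg : measurable_fun pos g.
  by apply: ge0_emeasurable_sum => // m r _ _; exact: abse_ge0.
have intg : (\int[mu]_(r in pos) g r < +oo)%E.
  rewrite integral_nneseries//.
  under eq_eseriesr do rewrite integral_norm_term// muleC.
  have /fineK <- := gauss_moment_fin_num n t0.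
  rewrite nneseriesZl; last first.
    by move=> m _; rewrite lee_fin exp_coeff_ge0// divr_ge0 ?sqr_ge0// mulr_ge0// ltW.
  rewrite (_ : (\sum_(m <oo) _)%E = (expR (k ^+ 2 / (4 * t)))%:E) ?ltry//.
  apply/cvg_lim => //; rewrite (_ : (fun N => _) =
    EFin \o series (exp_coeff (k ^+ 2 / (4 * t)))).
    by apply: cvg_EFin; [exact: nearW|exact: is_cvg_series_exp_coeff].
  by apply/funext => N; rewrite /series/= sumEFin.
have [||||||intf _ cvgf] := @dominated_convergence _ _ R mu pos _ f_
  (EFin \o (fun r => gauss_weight t n r * radial_cos n.+1 (k * r))) g.
- by [].
- move=> N; apply/measurable_EFinP; apply: measurable_sum => m; exact: measurable_term.
- apply/measurable_EFinP/measurable_funTS/measurable_funM.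
    exact: measurable_gauss_weight.
  exact: measurable_radial_cos.
- apply: aeW => r _; apply: cvg_EFin; first exact: nearW.
  rewrite (_ : _ \o _ = (fun N => gauss_weight t n r *
    series (radial_cos_coeff n.+1 (k * r)) N)).
    by apply: cvgM; [exact: cvg_cst|exact: cvg_radial_cos].
  by apply/funext => N; rewrite /f_/= /series/= mulr_sumr big_mkord.
- apply/integrableP; split => //; under eq_integral.
    move=> r _; rewrite gee0_abs; last first.
      by apply: nneseries_ge0 => m _ _; exact: abse_ge0.
    over.
  by [].
- apply: aeW => r N _; rewrite /f_ /g -sumEFin.
  apply: le_trans (lee_abs_sum _ _ _) _.
  rewrite -(big_mkord xpredT (fun m => `|(term t k n m r)%:E|%E)).
  by apply: nneseries_lim_ge => m _ _; exact: abse_ge0.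
split=> //; apply: cvg_unique cvgf _ => //.
rewrite (_ : [sequence _]_N = (fun N => gauss_moment t n *
    (series (exp_coeff (- (k ^+ 2 / (4 * t)))) N)%:E)%E).
  apply: cvgeZl; first exact: gauss_moment_fin_num.
  by apply: cvg_EFin; [exact: nearW|exact: is_cvg_series_exp_coeff].
apply/funext => N; rewrite /f_/=.
under eq_integral do rewrite -sumEFin.
rewrite integral_sum//.
  rewrite /series/= big_mkord -sumEFin fin_num_sume_distrr ?gauss_moment_fin_num//.
  by apply: eq_bigr => m _; rewrite integral_term// muleC.
move=> m; apply/integrableP; split.
  by apply/measurable_EFinP; exact: measurable_term.
rewrite integral_norm_term//; have /fineK <- := gauss_moment_fin_num n t0.
by rewrite -EFinM ltry.
Qed.
End gaussian_transform.

(** * Gaussian Fourier transform on R^d *)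

Section gaussian_fourier.
Context (R : realType).
Local Notation mR := (measurableTypeR R).
Local Notation mu := (@lebesgue_measure R).

Lemma ge0_integral_fold (f : mR -> \bar R) : measurable_fun [set: mR] f ->
  (forall x, 0 <= f x)%E ->
  (\int[mu]_x f x = \int[mu]_(x in `[0%R, +oo[) (f x + f (- x)%R))%E.
Proof.
move=> mf f0.
have mfN : measurable_fun [set: mR] (f \o -%R) by exact: measurableT_comp.
rewrite ge0_integralD//; last 2 first.
- exact: measurable_funTS.
- exact: measurable_funTS.
rewrite (ge0_integration_by_substitution0 mfN); last by move=> r /=.
rewrite -(setUv `[0%R, +oo[%classic) ge0_integral_setU//; last 3 first.
- exact: measurableC.
- by rewrite setUv.
- exact/disj_setPCl.
congr (_ + _)%E; rewrite setCitvr integral_itv_bndo_bndc; last exact: measurable_funTS.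
by apply: eq_integral => x _ /=; rewrite opprK.
Qed.

(** The total mass (pi / t)^(1/2) of exp (- t x^2) on the line. *)
Definition gauss_mass (t : R) : R := Num.sqrt pi / t `^ 2^-1.

Lemma gauss_mass_ge0 t : 0 <= gauss_mass t.
Proof. by rewrite divr_ge0 ?sqrtr_ge0 ?powR_ge0. Qed.

Let gauss_moment0 t : 0 < t -> gauss_moment t 0 = (gauss_mass t / 2)%:E.
Proof.
move=> t0; rewrite gauss_momentE// -[1%:R / 2]/(1 / 2) mul1r Gamma_half.
by congr EFin; rewrite /gauss_mass invfM; ring.
Qed.

(** Adding 1 to the oscillating term keeps the integrand nonnegative, and the
    phase [b] and amplitude [c] make the statement stable under integrating one
    coordinate at a time. Folding the line onto the half-line removes the odd
    part, and the cosine that remains is Omega_1. *)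
Lemma integral_gauss_cos (t k c b : R) : 0 < t -> `|c| <= 1 ->
  (\int[mu]_x (expR (- (t * x ^+ 2)) * (1 + c * cos (k * x + b)))%:E =
   (gauss_mass t * (1 + c * expR (- (k ^+ 2 / (4 * t))) * cos b))%:E)%E.
Proof.
move=> t0 c1; rewrite ge0_integral_fold/=; last 2 first.
- apply/measurable_EFinP/measurable_funM.
    by have := measurable_gauss_weight t 0; rewrite /gauss_weight;
      under eq_fun do rewrite expr0 mul1r.
  apply: measurable_funD => //; apply: measurable_funM => //.
  apply: measurableT_comp; first by apply: continuous_measurable_fun; exact: continuous_cos.
  by apply: measurable_funD => //; exact: measurable_funM.
- move=> x; rewrite lee_fin mulr_ge0 ?expR_ge0// -lerBlDl sub0r.
  rewrite lerNl (le_trans (ler_norm _))// normrN normrM.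
  by rewrite mulr_ile1 ?cos_max.
have [intc intE] := @integral_gauss_radial_cos R t k 0 t0.
transitivity (\int[mu]_(x in `[0%R, +oo[) (2%:E * (gauss_weight t 0 x)%:E +
    (2 * c * cos b)%:E * (gauss_weight t 0 x * radial_cos 1 (k * x))%:E))%E.
  apply: eq_integral => x _; rewrite -EFinD -!EFinM -EFinD; congr EFin.
  by rewrite radial_cos1 /gauss_weight expr0 mulrN !cosD sinN cosN sqrrN; ring.
have intg := integrable_gauss_weight 0 t0.
rewrite integralD//; [|exact: integrableZl|exact: integrableZl].
rewrite integralZl// integralZl// intE -/(gauss_moment t 0) gauss_moment0//.
by rewrite -!EFinM -EFinD; congr EFin; field.
Qed.

End gaussian_fourier.

Section lebesgue_tuple_integration.
Local Open Scope ereal_scope.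
Context (R : realType).
Local Notation mR := (measurableTypeR R).
Local Notation mu := (@lebesgue_measure R).

Lemma integral_lebesgue_tuple0 (f : 0.-tuple mR -> \bar R) :
  measurable_fun [set: 0.-tuple mR] f ->
  \int[lebesgue_tuple R 0]_x f x = f [tuple].
Proof.
move=> mf; transitivity (\int[\d_ ([tuple] : 0.-tuple mR)]_x f x).
  by apply: eq_measure_integral.
by rewrite integral_dirac// diracT mul1e.
Qed.

(** Tonelli's theorem for the first coordinate. *)
Lemma integral_lebesgue_tupleS n (f : n.+1.-tuple mR -> \bar R) :
  measurable_fun [set: n.+1.-tuple mR] f -> (forall x, 0 <= f x) ->
  \int[lebesgue_tuple R n.+1]_x f x =
  \int[lebesgue_tuple R n]_y \int[mu]_x f [tuple of x :: y].
Proof.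
move=> mf f0.
have mcons : measurable_fun [set: mR * n.-tuple mR]
    (fun x => [tuple of x.1 :: x.2] : n.+1.-tuple mR).
  exact: measurable_cons.
pose p := measure_function_pushforward__canonical__measure_function_Measure
  (mu \x lebesgue_tuple R n) mcons.
transitivity (\int[p]_x f x); first exact: eq_measure_integral.
rewrite ge0_integral_pushforward// preimage_setT.
apply: (@fubini_tonelli2 _ _ mR (n.-tuple mR) R mu (lebesgue_tuple R n)
  (fun x => f [tuple of x.1 :: x.2])) => //.
exact: (measurableT_comp mf mcons).
Qed.

Lemma measurable_dotp n (k : n.-tuple R) :
  measurable_fun [set: n.-tuple mR] (dotp k : n.-tuple mR -> mR).
Proof.
apply: measurable_sum => i; apply: measurable_funM => //.
exact: measurable_tnth.
Qed.

Definition sqnorm n (x : n.-tuple R) : R := dotp x x.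

Lemma measurable_sqnorm n :
  measurable_fun [set: n.-tuple mR] (@sqnorm n : n.-tuple mR -> mR).
Proof.
apply: measurable_sum => i; apply: measurable_funM; exact: measurable_tnth.
Qed.

Lemma sqnorm_ge0 n (x : n.-tuple R) : (0 <= sqnorm x)%R.
Proof. by apply: sumr_ge0 => i _; rewrite -expr2 sqr_ge0. Qed.

Lemma dotp_cons n (x y : R) (s t : n.-tuple R) :
  dotp [tuple of x :: s] [tuple of y :: t] = (x * y + dotp s t)%R.
Proof.
rewrite /dotp big_ord_recl; congr (_ + _)%R.
by apply: eq_bigr => i _; rewrite !tnthS.
Qed.

Lemma measurable_gauss_cos n t (k : n.-tuple R) c b :
  measurable_fun [set: n.-tuple mR]
    (fun x => expR (- (t * sqnorm x)) * (1 + c * cos (dotp k x + b)))%R.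
Proof.
apply: measurable_funM.
  apply: measurableT_comp => //; apply: measurableT_comp => //.
  by apply: measurable_funM => //; exact: measurable_sqnorm.
apply: measurable_funD => //; apply: measurable_funM => //.
apply: measurableT_comp.
  by apply: continuous_measurable_fun; exact: continuous_cos.
by apply: measurable_funD => //; exact: measurable_dotp.
Qed.

Lemma gauss_cos_ge0 n t (k x : n.-tuple R) c b : (`|c| <= 1)%R ->
  (0 <= expR (- (t * sqnorm x)) * (1 + c * cos (dotp k x + b)))%R.
Proof.
move=> c1; rewrite mulr_ge0 ?expR_ge0// -lerBlDl sub0r.
rewrite lerNl (le_trans (ler_norm _))// normrN normrM.
by rewrite mulr_ile1 ?cos_max.
Qed.

(** Integrating out the first coordinate multiplies the amplitude [c] by
    exp (- k_0^2 / 4t) and leaves the rest of k . x as a phase. *)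
Lemma integral_gauss_cos_tuple n (t : R) (k : n.-tuple R) (c b : R) :
  (0 < t)%R -> (`|c| <= 1)%R ->
  \int[lebesgue_tuple R n]_x
     (expR (- (t * sqnorm x)) * (1 + c * cos (dotp k x + b)))%:E =
  (gauss_mass t ^+ n *
    (1 + c * expR (- (sqnorm k / (4 * t))) * cos b))%:E.
Proof.
move=> t0; elim: n => [|n IH] in k c b *; move=> c1.
  rewrite integral_lebesgue_tuple0; last first.
    by apply/measurable_EFinP; exact: measurable_gauss_cos.
  by rewrite /sqnorm /dotp !big_ord0 mulr0 mul0r oppr0 expR0 add0r mulr1.
rewrite integral_lebesgue_tupleS; last 2 first.
- by apply/measurable_EFinP; exact: measurable_gauss_cos.
- by move=> x; rewrite lee_fin gauss_cos_ge0.
case/tupleP: k => k0 k.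
have e1 : (`|c * expR (- (k0 ^+ 2 / (4 * t)))| <= 1)%R.
  rewrite normrM mulr_ile1// ger0_norm ?expR_ge0// expR_le1 oppr_le0.
  by rewrite divr_ge0 ?sqr_ge0// mulr_ge0// ltW.
transitivity (\int[lebesgue_tuple R n]_y ((gauss_mass t)%:E *
    (expR (- (t * sqnorm y)) *
      (1 + c * expR (- (k0 ^+ 2 / (4 * t))) * cos (dotp k y + b)))%:E)).
  apply: eq_integral => y _.
  transitivity (\int[mu]_x ((expR (- (t * sqnorm y)))%:E *
      (expR (- (t * x ^+ 2)) * (1 + c * cos (k0 * x + (dotp k y + b))))%:E)).
    apply: eq_integral => x _; rewrite -EFinM /sqnorm !dotp_cons; congr EFin.
    by rewrite -(addrA (k0 * x)%R) (mulrDr t) opprD expRD expr2; ring.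
  pose y0 := (dotp k y + b)%R.
  have mx : measurable_fun [set: mR] (fun x : mR =>
      (expR (- (t * x ^+ 2)) * (1 + c * cos (k0 * x + y0)))%:E).
    apply/measurable_EFinP/measurable_funM.
      apply: measurableT_comp => //; apply: measurableT_comp => //.
      by apply: measurable_funM => //; exact: measurable_funX.
    apply: measurable_funD => //; apply: measurable_funM => //.
    apply: measurableT_comp.
      by apply: continuous_measurable_fun; exact: continuous_cos.
    by apply: measurable_funD => //; exact: measurable_funM.
  have x_ge0 (x : mR) :
      0 <= (expR (- (t * x ^+ 2)) * (1 + c * cos (k0 * x + y0)))%:E.
    rewrite lee_fin mulr_ge0 ?expR_ge0// -lerBlDl sub0r lerNl.
    by rewrite (le_trans (ler_norm _))// normrN normrM mulr_ile1 ?cos_max.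
  rewrite ge0_integralZl_EFin ?expR_ge0//.
  rewrite integral_gauss_cos// -!EFinM; congr EFin; ring.
rewrite ge0_integralZl_EFin//; last 3 first.
- by move=> x _; rewrite lee_fin gauss_cos_ge0.
- by apply/measurable_EFinP; exact: measurable_gauss_cos.
- exact: gauss_mass_ge0.
rewrite IH// -EFinM; congr EFin.
rewrite [sqnorm [tuple of _]]dotp_cons -/(sqnorm k) -expr2 (mulrDl (k0 ^+ 2)%R).
rewrite opprD expRD (exprS (gauss_mass t)).
by ring.
Qed.

End lebesgue_tuple_integration.

(** * Reduction of radial integrals to the half-line *)

Section radial_reduction.
Local Open Scope ereal_scope.
Context (R : realType).
Local Notation mR := (measurableTypeR R).
Local Notation mu := (@lebesgue_measure R).
Local Notation pos := (`[0%R, +oo[%classic : set mR).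

(** The surface area of the unit sphere of R^d. *)
Definition sphere_area (d : nat) : R :=
  (2 * pi `^ (d%:R / 2) / Gamma (d%:R / 2))%R.

(** The total mass of exp (- t |x|^2) on R^d, computed in Cartesian and in
    radial form. *)
Lemma gauss_mass_sphere (t : R) n : (0 < t)%R ->
  (gauss_mass t ^+ n.+1)%:E = (sphere_area n.+1)%:E * gauss_moment t n.
Proof.
move=> t0; rewrite gauss_momentE// -EFinM; congr EFin.
have half (x : R) : (0 <= x)%R ->
    (x `^ 2^-1 ^+ n.+1 = x `^ (n.+1%:R / 2))%R.
  by move=> x0; rewrite -powR_mulrn ?powR_ge0// -powRrM mulrC.
rewrite /gauss_mass -powR12_sqrt ?pi_ge0// exprMn exprVn !half ?pi_ge0 ?ltW//.
have G0 := Gamma_half_gt0 R n; have T0 : (0 < t `^ (n.+1%:R / 2))%R.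
  exact: powR_gt0.
by rewrite /sphere_area; field; rewrite !gt_eqF.
Qed.

Variables (n : nat) (k : n.+1.-tuple R).
Let kappa : R := enorm k.

Let kappa2 : (kappa ^+ 2 = sqnorm k)%R.
Proof. by rewrite sqr_sqrtr// sqnorm_ge0. Qed.

(** The density W of |x| under (1 - cos (k . x)) dx. Nothing here makes it visibly
    nonnegative; that comes out of [radial_reduction]. *)
Definition radial_profile (r : R) : R :=
  (sphere_area n.+1 * (1 - radial_cos n.+1 (kappa * r)) * r ^+ n)%R.

Let measurable_radial_profile :
  measurable_fun [set: mR] (radial_profile : mR -> mR).
Proof.
apply: measurable_funM; last exact: measurable_funX.
apply: measurable_funM => //; apply: measurable_funB => //.
exact: measurable_radial_cos.
Qed.

(* Both transforms equal (pi / t)^(d/2) (1 - exp (- |k|^2 / 4t)). *)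
Let integral_radial_profile (t : R) : (0 < t)%R ->
  mu.-integrable pos
    (EFin \o (fun r => expR (- (t * r ^+ 2)) * radial_profile r)%R) /\
  \int[mu]_(r in pos) (expR (- (t * r ^+ 2)) * radial_profile r)%:E =
  \int[lebesgue_tuple R n.+1]_x
    (expR (- (t * sqnorm x)) * (1 - cos (dotp k x)))%:E.
Proof.
move=> t0.
have [intc intE] := @integral_gauss_radial_cos R t kappa n t0.
have intg := @integrable_gauss_weight R t n t0.
have wE r : (expR (- (t * r ^+ 2)) * radial_profile r)%:E =
    (sphere_area n.+1)%:E * ((gauss_weight t n r)%:E -
      (gauss_weight t n r * radial_cos n.+1 (kappa * r))%:E).
  by rewrite -EFinB -EFinM /radial_profile /gauss_weight; congr EFin; ring.
have intB : mu.-integrable pos (fun r => (gauss_weight t n r)%:E -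
    (gauss_weight t n r * radial_cos n.+1 (kappa * r))%:E).
  exact: integrableB.
split.
  have -> : EFin \o (fun r => expR (- (t * r ^+ 2)) * radial_profile r)%R =
     (fun r => (sphere_area n.+1)%:E * ((gauss_weight t n r)%:E -
      (gauss_weight t n r * radial_cos n.+1 (kappa * r))%:E)).
    by apply/funext => r /=; exact: wE.
  exact: integrableZl.
under eq_integral do rewrite wE.
rewrite integralZl// integralB// intE -/(gauss_moment t n).
have mE := gauss_mass_sphere n t0.
have N1 : (`|- 1 : R| <= 1)%R by rewrite normrN1.
have := @integral_gauss_cos_tuple R n.+1 t k (- 1) 0 t0 N1.
under eq_integral do rewrite mulN1r addr0.
move=> ->; rewrite kappa2 cos0 mulr1 mulN1r [RHS]EFinM mE.
have /fineK <- := gauss_moment_fin_num n t0.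
by rewrite -!EFinM; congr EFin; ring.
Qed.

Let profile_pos (r : R) : R := (\1_pos r * Num.max (radial_profile r) 0)%R.
Let profile_neg (r : R) : R := (\1_pos r * Num.max (- radial_profile r) 0)%R.

Let mprofile_pos : measurable_fun [set: mR] (profile_pos : mR -> R).
Proof.
apply: measurable_funM; first exact: measurable_indic.
by apply: measurable_maxr.
Qed.

Let mprofile_neg : measurable_fun [set: mR] (profile_neg : mR -> R).
Proof.
apply: measurable_funM; first exact: measurable_indic.
by apply: measurable_maxr => //; exact: measurableT_comp.
Qed.

Let profile_pos_ge0 r : (0 <= profile_pos r)%R.
Proof. by rewrite mulr_ge0// le_max lexx orbT. Qed.

Let profile_neg_ge0 r : (0 <= profile_neg r)%R.
Proof. by rewrite mulr_ge0// le_max lexx orbT. Qed.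

Let msqr : measurable_fun [set: mR] ((fun r => r ^+ 2)%R : mR -> mR).
Proof. exact: measurable_funX. Qed.

Let f (x : n.+1.-tuple mR) : R := (1 - cos (dotp k x))%R.

Let mf : measurable_fun [set: n.+1.-tuple mR] f.
Proof.
apply: measurable_funB => //; apply: measurableT_comp.
  by apply: continuous_measurable_fun; exact: continuous_cos.
exact: measurable_dotp.
Qed.

Let f_ge0 x : (0 <= f x)%R.
Proof. by rewrite subr_ge0 cos_le1. Qed.

(* The two parts of W are kept on opposite sides, so that the uniqueness theorem
   applies to nonnegative measures before the sign of W is known. *)
Let radial_balance (g : R -> \bar R) : measurable_fun [set: mR] g ->
  (forall y, 0 <= g y) ->
  \int[lebesgue_tuple R n.+1]_x (g (sqnorm x) * (f x)%:E) +
  \int[mu]_r (g (r ^+ 2)%R * (profile_neg r)%:E) =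
  \int[mu]_r (g (r ^+ 2)%R * (profile_pos r)%:E).
Proof.
move=> mg g0.
have [nu [nuE nuN nuL]] := nonneg_image_exists (lebesgue_tuple R n.+1)
  (@measurable_sqnorm R n.+1) mf (@sqnorm_ge0 R n.+1) f_ge0.
have sqr0 (r : mR) : (0 <= r ^+ 2)%R by exact: sqr_ge0.
have [np [npE npN npL]] := nonneg_image_exists mu msqr mprofile_pos sqr0
  profile_pos_ge0.
have [nm [nmE nmN nmL]] := nonneg_image_exists mu msqr mprofile_neg sqr0
  profile_neg_ge0.
pose k1 : {measure set mR -> \bar R} :=
  msum (fun i : nat => if i is 0%N then nu else nm) 2.
have integral_k1 (A : set mR) (h : mR -> \bar R) : measurable A ->
    (forall y, A y -> 0 <= h y) -> measurable_fun A h ->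
    \int[k1]_(y in A) h y = \int[nu]_(y in A) h y + \int[nm]_(y in A) h y.
  move=> mA h0 mh; rewrite ge0_integral_measure_sum//.
  by rewrite !big_ord_recl big_ord0 adde0.
rewrite -nuE// -nmE// -npE// -integral_k1//.
pose phi t (r : mR) := (expR (- (t * r ^+ 2)) * radial_profile r)%:E.
have phi_pos t r : ((phi t)^\+ \_ pos) r =
    (expR (- (t * r ^+ 2)) * profile_pos r)%:E.
  rewrite patchE /profile_pos indicE; case: ifPn => _; last by rewrite mul0r mulr0.
  by rewrite funeposE -EFin_max mul1r maxr_pMr ?expR_ge0// mulr0.
have phi_neg t r : ((phi t)^\- \_ pos) r =
    (expR (- (t * r ^+ 2)) * profile_neg r)%:E.
  rewrite patchE /profile_neg indicE; case: ifPn => _; last by rewrite mul0r mulr0.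
  by rewrite funenegE -EFinN -EFin_max mul1r maxr_pMr ?expR_ge0// mulr0 mulrN.
have key t : (0 < t)%R ->
    (\int[nu]_(y in pos) (expR (- (t * y)))%:E +
     \int[nm]_(y in pos) (expR (- (t * y)))%:E =
     \int[np]_(y in pos) (expR (- (t * y)))%:E) /\
    \int[np]_(y in pos) (expR (- (t * y)))%:E < +oo.
  move=> t0; rewrite nuL npL nmL.
  have [int_p intE] := integral_radial_profile t0.
  have -> : \int[mu]_r (expR (- (t * r ^+ 2)) * profile_pos r)%:E =
      \int[mu]_(r in pos) (phi t)^\+ r.
    by rewrite [RHS]integral_mkcond; apply: eq_integral => r _; rewrite phi_pos.
  have -> : \int[mu]_r (expR (- (t * r ^+ 2)) * profile_neg r)%:E =
      \int[mu]_(r in pos) (phi t)^\- r.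
    by rewrite [RHS]integral_mkcond; apply: eq_integral => r _; rewrite phi_neg.
  rewrite -intE integralE subeK//; last exact: integrable_neg_fin_num.
  by split=> //; exact: integral_funepos_lt_pinfty.
have k1E t : (0 < t)%R -> \int[k1]_(y in pos) (expR (- (t * y)))%:E =
    \int[np]_(y in pos) (expR (- (t * y)))%:E.
  move=> t0; rewrite -(key t t0).1; apply: integral_k1 => //.
  apply/measurable_EFinP/measurable_funTS; apply: measurableT_comp => //.
  by apply: measurableT_comp => //; exact: measurable_funM.
apply: (@laplace_unique R k1 np) => //.
- by rewrite /k1/= /msum !big_ord_recl big_ord0 nuN nmN !adde0.
- under eq_integral do rewrite -[X in (- X)%R]mul1r.
  by rewrite k1E//; exact: (key 1%R ltr01).2.
- by move=> j; exact: k1E.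
Qed.

(** The functions of |x| are written as functions [g] of |x|^2. The second
    conclusion says that W is nonnegative almost everywhere where [g] does not
    vanish: testing the balance on [g] restricted to W < 0 makes the W^+ side
    vanish, hence also the W^- term. *)
Lemma radial_reduction (g : R -> \bar R) : measurable_fun [set: mR] g ->
  (forall y, 0 <= g y) ->
  \int[lebesgue_tuple R n.+1]_x (g (sqnorm x) * (1 - cos (dotp k x))%:E) =
  \int[mu]_(r in pos) (g (r ^+ 2)%R * (Num.max (radial_profile r) 0)%:E) /\
  \int[mu]_(r in pos) (g (r ^+ 2)%R * (Num.max (- radial_profile r) 0)%:E) = 0.
Proof.
move=> mg g0.
have patch_pos (h : R -> R) :
    \int[mu]_(r in pos) (g (r ^+ 2)%R * (h r)%:E) =
    \int[mu]_r (g (r ^+ 2)%R * (\1_pos r * h r)%:E).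
  rewrite [LHS]integral_mkcond; apply: eq_integral => r _.
  by rewrite patchE indicE; case: ifPn => _; rewrite ?mul1r// mul0r mule0.
pose S : set mR := [set y | (radial_profile (Num.sqrt y) < 0)%R].
have mS : measurable S.
  rewrite (_ : S = (radial_profile \o Num.sqrt) @^-1` `]-oo, 0%R[); last first.
    by apply/seteqP; split => y /=; rewrite in_itv.
  rewrite -[X in measurable X]setTI.
  apply: (measurableT_comp measurable_radial_profile) => //.
  by apply: continuous_measurable_fun; exact: sqrt_continuous.
have neg0 : \int[mu]_r (g (r ^+ 2)%R * (profile_neg r)%:E) = 0.
  have gS0 y : 0 <= g y * (\1_S y)%:E by rewrite mule_ge0// lee_fin.
  have mgS : measurable_fun [set: mR] (fun y => g y * (\1_S y)%:E).
    by apply: emeasurable_funM => //; exact/measurable_EFinP.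
  have := radial_balance mgS gS0.
  rewrite [RHS](_ : _ = 0); last first.
    apply: integral0_eq => r _; rewrite /profile_pos [\1_pos r]indicE.
    have [|_] := boolP (r \in pos); last by rewrite mul0r mule0.
    rewrite inE/= in_itv/= andbT => r0; rewrite mul1r indicE.
    have [|_] := boolP ((r ^+ 2)%R \in S); last by rewrite mule0 mul0e.
    rewrite inE/= /S/= sqrtr_sqr ger0_norm// => W0.
    by rewrite max_r ?mule0// ltW.
  move=> /eqP; rewrite padde_eq0; last 2 first.
  - by apply: integral_ge0 => x _; rewrite mule_ge0// lee_fin.
  - by apply: integral_ge0 => r _; rewrite mule_ge0// lee_fin.
  move=> /andP[_ /eqP]; rewrite (_ : (\int[mu]_r (_ * _)) =
    \int[mu]_r (g (r ^+ 2)%R * (profile_neg r)%:E))//.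
  apply: eq_integral => r _; rewrite /profile_neg [\1_pos r]indicE.
  have [|_] := boolP (r \in pos); last by rewrite mul0r !mule0.
  rewrite inE/= in_itv/= andbT => r0; rewrite mul1r indicE.
  have [_|] := boolP ((r ^+ 2)%R \in S); first by rewrite mule1.
  rewrite notin_setE/= /S/= sqrtr_sqr ger0_norm// => /negP; rewrite -leNgt => W0.
  by rewrite max_r ?oppr_le0// !mule0.
rewrite !patch_pos; split; last exact: neg0.
by rewrite -(radial_balance mg g0) neg0 adde0.
Qed.

Let sin_pos (x : n.+1.-tuple mR) : R := Num.max (sin (dotp k x)) 0%R.
Let sin_neg (x : n.+1.-tuple mR) : R := Num.max (- sin (dotp k x))%R 0%R.

Let msin : measurable_fun [set: n.+1.-tuple mR] (fun x => sin (dotp k x)).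
Proof.
apply: measurableT_comp; last exact: measurable_dotp.
by apply: continuous_measurable_fun; exact: continuous_sin.
Qed.

Let msin_pos : measurable_fun [set: n.+1.-tuple mR] sin_pos.
Proof. exact: measurable_maxr. Qed.

Let msin_neg : measurable_fun [set: n.+1.-tuple mR] sin_neg.
Proof. by apply: measurable_maxr => //; exact: measurableT_comp. Qed.

(** The transform of sin (k . x) is the case of phase - pi/2 and vanishes; adding
    the transform of 1 keeps all integrands nonnegative, and it is finite, so
    that it can be cancelled. *)
Lemma radial_sin_cancel (g : R -> \bar R) : measurable_fun [set: mR] g ->
  (forall y, 0 <= g y) ->
  \int[lebesgue_tuple R n.+1]_x
    (g (sqnorm x) * (Num.max (sin (dotp k x)) 0)%R%:E) =
  \int[lebesgue_tuple R n.+1]_x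
    (g (sqnorm x) * (Num.max (- sin (dotp k x)) 0)%R%:E).
Proof.
move=> mg g0.
have p0 x : (0 <= sin_pos x)%R by rewrite le_max lexx orbT.
have n0 x : (0 <= sin_neg x)%R by rewrite le_max lexx orbT.
have [np [npE npN npL]] := nonneg_image_exists (lebesgue_tuple R n.+1)
  (@measurable_sqnorm R n.+1) msin_pos (@sqnorm_ge0 R n.+1) p0.
have [nm [nmE nmN nmL]] := nonneg_image_exists (lebesgue_tuple R n.+1)
  (@measurable_sqnorm R n.+1) msin_neg (@sqnorm_ge0 R n.+1) n0.
rewrite -npE// -nmE//.
pose G t (x : n.+1.-tuple mR) : R := expR (- (t * sqnorm x)).
have mG t : measurable_fun [set: n.+1.-tuple mR] (G t).
  apply: measurableT_comp => //; apply: measurableT_comp => //.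
  by apply: measurable_funM => //; exact: measurable_sqnorm.
have G0 t x : (0 <= G t x)%R by exact: expR_ge0.
have intG t : (0 < t)%R ->
    \int[lebesgue_tuple R n.+1]_x (G t x)%:E = (gauss_mass t ^+ n.+1)%:E.
  move=> t0; have := @integral_gauss_cos_tuple R n.+1 t k 0 0 t0.
  rewrite normr0 ler01 => /(_ isT).
  under eq_integral do rewrite mul0r addr0 mulr1.
  by rewrite !mul0r addr0 mulr1.
have key t : (0 < t)%R ->
  \int[lebesgue_tuple R n.+1]_x (G t x * sin_pos x)%:E =
  \int[lebesgue_tuple R n.+1]_x (G t x * sin_neg x)%:E.
  move=> t0; have := @integral_gauss_cos_tuple R n.+1 t k 1 (- (pi / 2)) t0.
  rewrite normr1 lexx => /(_ isT).
  rewrite cosN cos_pihalf mulr0 addr0 mulr1 -(intG t t0) => e.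
  have : \int[lebesgue_tuple R n.+1]_x (G t x)%:E +
         \int[lebesgue_tuple R n.+1]_x (G t x * sin_pos x)%:E =
         \int[lebesgue_tuple R n.+1]_x (G t x)%:E +
         \int[lebesgue_tuple R n.+1]_x (G t x * sin_neg x)%:E.
    rewrite -{2}e -!ge0_integralD//.
    - apply: eq_integral => x _; rewrite -!EFinD; congr EFin.
      rewrite mul1r cosD cosN sinN cos_pihalf sin_pihalf -/(G t x).
      have -> : sin (dotp k x) = (sin_pos x - sin_neg x)%R.
        by rewrite /sin_pos /sin_neg oppr_max opprK oppr0 addr_max_min addr0.
      by ring.
    - by apply/measurable_EFinP; exact: measurable_gauss_cos.
    - by move=> x _; rewrite lee_fin mulr_ge0.
    - by apply/measurable_EFinP/measurable_funM.
    - by move=> x _; rewrite lee_fin.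
    - exact/measurable_EFinP.
    - by move=> x _; rewrite lee_fin mulr_ge0.
    - by apply/measurable_EFinP/measurable_funM.
  rewrite ![(\int[_]_x (G t x)%:E + _)]addeC intG// => /(congr1
    (fun z => z - (gauss_mass t ^+ n.+1)%:E)).
  by rewrite !addeK.
apply: (@laplace_unique R np nm) => //.
- under eq_integral do rewrite -[X in (- X)%R]mul1r.
  rewrite npL.
  apply: (@le_lt_trans _ _ (\int[lebesgue_tuple R n.+1]_x (G 1%R x)%:E)).
    apply: ge0_le_integral => //.
    + by move=> x _; rewrite lee_fin mulr_ge0// expR_ge0.
    + by apply/measurable_EFinP; exact: (measurable_funM (mG 1%R) msin_pos).
    + exact/measurable_EFinP.
    + move=> x _; rewrite lee_fin ler_piMr// ge_max sin_le1 ler01//.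
  by rewrite intG// ltry.
- by move=> j; rewrite npL nmL; exact: key.
Qed.

End radial_reduction.

(** * The Bessel function *)

Section bessel_ratio.
Context (R : realType) (n : nat).
Let nu : R := (n.+1%:R - 2) / 2.
Let C : R := 2^-1 `^ nu / Gamma (n.+1%:R / 2).

Let Gamma_radial_fact m :
  m`!%:R * Gamma (m%:R + nu + 1) * 4 ^+ m =
  (radial_fact n.+1 m)%:R * Gamma (n.+1%:R / 2) :> R.
Proof.
have nuE i : i%:R + nu + 1 = (n + 2 * i).+1%:R / 2 :> R.
  by rewrite /nu -!natr1 natrD natrM; field.
elim: m => [|m IH].
  by rewrite nuE /radial_fact big_ord0 muln0 addn0 fact0 expr0 mulr1.
rewrite radial_factS natrM [RHS]mulrAC -IH !nuE.
rewrite (_ : (n + 2 * m.+1).+1 = (n + 2 * m).+3) ?Gamma_half_rec; last first.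
  by rewrite mulnS addnCA.
have -> : (2 * m.+1 * (2 * m + n.+1))%:R =
    4 * m.+1%:R * ((n + 2 * m).+1%:R / 2) :> R.
  by rewrite addnS (addnC (2 * m)%N) !natrM; field.
by rewrite factS natrM (exprS 4); ring.
Qed.

Let besselJ_pos x : 0 < x -> besselJ nu x = C * x `^ nu * radial_cos n.+1 x.
Proof.
move=> x0; apply/cvg_lim => //.
rewrite (_ : series _ = (fun N => C * x `^ nu *
    series (radial_cos_coeff n.+1 x) N)).
  by apply: cvgM; [exact: cvg_cst|exact: cvg_radial_cos].
apply/funext => N; rewrite /series/= mulr_sumr; apply: eq_bigr => m _.
have x20 : 0 <= x / 2 by rewrite divr_ge0// ltW.
rewrite powRD; last by rewrite mulf_neq0 ?implybT// ?gt_eqF// invr_gt0.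
rewrite -natrM powR_mulrn// (powRM _ (ltW x0)) ?invr_ge0//.
have G0 : Gamma (n.+1%:R / 2 : R) != 0 by rewrite gt_eqF// Gamma_half_gt0.
have f0 : (radial_fact n.+1 m)%:R != 0 :> R.
  by rewrite pnatr_eq0 -lt0n radial_fact_gt0.
have := Gamma_radial_fact m.
set A := m`!%:R * _; set P := (radial_fact _ _)%:R; set G := Gamma (_ / 2) => e.
have B0 : (4 : R) ^+ m != 0 by rewrite expf_neq0.
have A0 : A != 0.
  by apply: contraTneq (mulf_neq0 f0 G0) => A0; rewrite -e A0 mul0r eqxx.
rewrite /radial_cos_coeff /C exprMn exprVn exprM.
have -> : (2 : R) ^+ (2 * m) = 4 ^+ m by rewrite exprM; congr (_ ^+ _); ring.
transitivity ((-1) ^+ m * (x ^+ 2) ^+ m * x `^ nu * 2^-1 `^ nu / (A * 4 ^+ m)).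
  by field; rewrite A0 B0.
by rewrite e -/G; field; rewrite G0 f0.
Qed.

(** At 0 the value is the right limit, which exists because Omega_d tends to 1
    there. *)
Lemma besselJ_ratioE z : 0 <= z ->
  besselJ_ratio nu z = C * radial_cos n.+1 z.
Proof.
have ratio x : 0 < x -> besselJ nu x / x `^ nu = C * radial_cos n.+1 x.
  move=> x0; rewrite besselJ_pos// mulrAC mulfK//.
  by rewrite gt_eqF// powR_gt0.
rewrite le_eqVlt /besselJ_ratio => /predU1P[<-|z0]; last by rewrite gt_eqF ?ratio.
rewrite eqxx; apply/cvg_lim => //.
have near1 w : `|radial_cos n.+1 w - 1| <= expR (w ^+ 2) - 1 :> R.
  exact: radial_cos_near1.
have -> : radial_cos n.+1 0 = 1 :> R.
  apply/eqP; rewrite -subr_eq0 -normr_le0 (le_trans (near1 0))//.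
  by rewrite expr0n/= expR0 subrr.
apply: (@cvg_trans _ (C * radial_cos n.+1 x @[x --> 0^'+])).
  by apply: near_eq_cvg; near=> x; rewrite ratio.
apply: cvgM; first exact: cvg_cst.
have e1 : expR (x ^+ 2) @[x --> 0^'+] --> (1 : R).
  apply: cvg_at_right_filter; 
  rewrite (_ : 1 = expR (0 ^+ 2)); last by rewrite expr0n expR0.
  apply: (@continuous_comp R R R (fun x : R => x ^+ 2) expR).
    exact: exprn_continuous.
  exact: continuous_expR.
apply: (@squeeze_cvgr _ _ _ R (fun x => 1 - (expR (x ^+ 2) - 1))
    (fun x => 1 + (expR (x ^+ 2) - 1))).
- by near=> x; have := near1 x; rewrite ler_distl.
- rewrite -[X in _ --> X]subr0 -{2}(subrr (1 : R)).
  by apply: cvgB; [exact: cvg_cst|apply: cvgB => //; exact: cvg_cst].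
- rewrite -[X in _ --> X]addr0 -{2}(subrr (1 : R)).
  by apply: cvgD; [exact: cvg_cst|apply: cvgB => //; exact: cvg_cst].
Unshelve. all: by end_near.
Qed.

(** The powers of 2 combine as 2^(d/2) 2^(- nu) = 2. *)
Lemma sphere_area_bessel z : 0 <= z ->
  (2 * pi) `^ (n.+1%:R / 2) * besselJ_ratio nu z
    - 2 * pi `^ (n.+1%:R / 2) / Gamma (n.+1%:R / 2) =
  - (sphere_area R n.+1 * (1 - radial_cos n.+1 z)) :> R.
Proof.
move=> z0; rewrite besselJ_ratioE// /C /sphere_area powRM ?pi_ge0//.
have e : (2 : R) `^ (n.+1%:R / 2) * 2^-1 `^ nu = 2.
  have -> : (2^-1 : R) `^ nu = 2 `^ (- nu).
    by rewrite -[X in X `^ nu]powR_inv1// -powRrM mulN1r.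
  rewrite -powRD; last by rewrite pnatr_eq0 implybT.
  by rewrite -[RHS]powRr1//; congr powR; rewrite /nu; field.
have G0 : Gamma (n.+1%:R / 2 : R) != 0 by rewrite gt_eqF// Gamma_half_gt0.
transitivity ((2 `^ (n.+1%:R / 2) * 2^-1 `^ nu) * pi `^ (n.+1%:R / 2) /
    Gamma (n.+1%:R / 2) * radial_cos n.+1 z -
  2 * pi `^ (n.+1%:R / 2) / Gamma (n.+1%:R / 2)); first by field.
by rewrite e; field.
Qed.
End bessel_ratio.

(** * Fourier spectrum *)

Local Open Scope complex_scope.

Section spectrum_parts.
Local Open Scope ereal_scope.
Context (R : realType) (n : nat) (delta : R) (rho : R -> R).
Local Notation mR := (measurableTypeR R).
Local Notation mu := (@lebesgue_measure R).
Local Notation pos := (`[0%R, +oo[%classic : set mR).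
Local Notation shell := (`[0%R, delta]%classic : set mR).
Hypothesis mrho : measurable_fun shell rho.
Hypothesis rho_ge0 : forall r : R, (0 <= r)%R -> (0 <= rho r)%R.

Let ball : set (n.+1.-tuple mR) := [set x | (enorm x <= delta)%R].

Let g (y : R) : \bar R := (((rho : mR -> R) \_ shell) (Num.sqrt y))%:E.

Let measurable_sqrt : measurable_fun [set: mR] (Num.sqrt : mR -> mR).
Proof. by apply: continuous_measurable_fun; exact: sqrt_continuous. Qed.

Let mg : measurable_fun [set: mR] g.
Proof.
apply/measurable_EFinP; apply: measurableT_comp => //.
have mshell : measurable shell by [].
exact: (measurable_restrictT rho mshell).1 mrho.
Qed.

Let gE y : g y = if (Num.sqrt y <= delta)%R then (rho (Num.sqrt y))%:E else 0.
Proof.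
rewrite /g patchE mem_setE in_itv/= sqrtr_ge0/=.
by case: ifP.
Qed.

Let g_ge0 y : 0 <= g y.
Proof. by rewrite gE; case: ifP => // _; rewrite lee_fin rho_ge0 ?sqrtr_ge0. Qed.

Let integral_ball (h : n.+1.-tuple R -> R) :
  \int[lebesgue_tuple R n.+1]_(x in ball) (rho (enorm x) * h x)%:E =
  \int[lebesgue_tuple R n.+1]_x (g (sqnorm x) * (h x)%:E).
Proof.
rewrite integral_mkcond; apply: eq_integral => x _.
rewrite patchE gE -/(enorm x); have [xB|xB] := boolP (enorm x <= delta)%R.
  by rewrite mem_set// EFinM.
by rewrite memNset ?mul0e//; exact/negP.
Qed.

Let integral_shell (h : R -> R) :
  \int[mu]_(r in shell) (rho r * h r)%:E =
  \int[mu]_(r in pos) (g (r ^+ 2)%R * (h r)%:E).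
Proof.
rewrite integral_mkcond [RHS]integral_mkcond; apply: eq_integral => r _.
rewrite !patchE gE !mem_setE !in_itv/= andbT.
have [r0|//] := leP 0%R r; rewrite sqrtr_sqr ger0_norm//=.
by case: ifP => _; rewrite ?EFinM// mul0e.
Qed.

Variable k : n.+1.-tuple R.

(** The bracket of the one-dimensional integrand is - W. Its positive part
    contributes 0, and the negative part is the integral given by
    [radial_reduction], possibly infinite on both sides. *)
Lemma spectrum_re :
  \int[lebesgue_tuple R n.+1]_(x in ball)
    (rho (enorm x) * (cos (dotp k x) - 1))%:E =
  \int[mu]_(r in shell) (rho r * - radial_profile k r)%:E.
Proof.
have [redE red0] := radial_reduction k mg g_ge0.
rewrite integral_ball.
rewrite (_ : \int[_]_x _ = - \int[lebesgue_tuple R n.+1]_x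
    (g (sqnorm x) * (1 - cos (dotp k x))%:E)); last first.
  rewrite -integral_ge0N.
    by apply: eq_integral => x _; rewrite -muleN -EFinN opprB.
  by move=> x _; rewrite mule_ge0// lee_fin subr_ge0 cos_le1.
rewrite redE [RHS]integralE.
rewrite (_ : \int[mu]_(r in shell) _^\+ r = 0); last first.
  rewrite -red0 -integral_shell; apply: eq_integral => r.
  rewrite inE/= in_itv/= => /andP[r0 _].
  by rewrite funeposE -EFin_max maxr_pMr ?rho_ge0// mulr0.
rewrite sub0e; congr (- _); rewrite -integral_shell.
apply: eq_integral => r; rewrite inE/= in_itv/= => /andP[r0 _].
by rewrite funenegE -EFinN -EFin_max maxr_pMr ?rho_ge0// mulrN opprK mulr0.
Qed.

(** The positive and negative parts have the same integral X, which may be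
    infinite; the extended difference X - X is then -oo, whose real value is 0
    as well. *)
Lemma spectrum_im :
  \int[lebesgue_tuple R n.+1]_(x in ball)
    (rho (enorm x) * sin (dotp k x))%:E = 0 \/
  \int[lebesgue_tuple R n.+1]_(x in ball)
    (rho (enorm x) * sin (dotp k x))%:E = -oo.
Proof.
have red := radial_sin_cancel k mg g_ge0.
rewrite integralE.
rewrite (_ : \int[_]_(x in ball) _^\+ x = \int[lebesgue_tuple R n.+1]_x
    (g (sqnorm x) * (Num.max (sin (dotp k x)) 0)%R%:E)); last first.
  rewrite -integral_ball; apply: eq_integral => x _.
  by rewrite funeposE -EFin_max maxr_pMr ?rho_ge0 ?sqrtr_ge0// mulr0.
rewrite (_ : \int[_]_(x in ball) _^\- x = \int[lebesgue_tuple R n.+1]_x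
    (g (sqnorm x) * (Num.max (- sin (dotp k x)) 0)%R%:E)); last first.
  rewrite -integral_ball; apply: eq_integral => x _.
  by rewrite funenegE -EFinN -EFin_max maxr_pMr ?rho_ge0 ?sqrtr_ge0// mulr0 mulrN.
rewrite red; set X := (X in X - X).
have : 0 <= X by apply: integral_ge0 => x _; rewrite mule_ge0// lee_fin le_max lexx orbT.
by case: X => [r _|_|//]; [left; rewrite subee|right].
Qed.

End spectrum_parts.

Theorem theorem2p1 (R : realType) (d : nat) (delta : R) (rho : R -> R)
    (k : d.-tuple int)
    (d_gt0 : (0 < d)%N)
    (delta_gt0 : 0 < delta)
    (rho_measurable : measurable_fun `[0, delta] rho)
    (rho_ge0 : forall r : R, 0 <= r -> 0 <= rho r)
    (rho_support : forall r : R, delta < r -> rho r = 0) :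
  fourier_spectrum delta rho k =
  (\int[@lebesgue_measure R]_(r in `[0, delta])
     (rho r *
      ((2 * pi) `^ (d%:R / 2) *
         besselJ_ratio ((d%:R - 2) / 2) (enorm (real_tuple R k) * r)
       - 2 * pi `^ (d%:R / 2) / Gamma (d%:R / 2)) *
      r ^+ (d - 1)))%:C.
Proof.
case: d => // n in k d_gt0 *.
rewrite /fourier_spectrum /Cintegral; congr (_ +i* _).
- rewrite /Rintegral; congr fine.
  transitivity (\int[lebesgue_tuple R n.+1]_(x in [set r | (enorm r <= delta)%R])
    (rho (enorm x) * (cos (dotp (real_tuple R k) x) - 1))%:E)%E.
    by apply: eq_integral => x _ /=; congr EFin; ring.
  rewrite (spectrum_re rho_measurable rho_ge0); apply: eq_integral => r.
  rewrite inE/= in_itv/= => /andP[r0 _]; congr EFin.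
  have z0 : 0 <= enorm (real_tuple R k) * r by rewrite mulr_ge0 ?sqrtr_ge0.
  by rewrite sphere_area_bessel// subn1/= /radial_profile; ring.
- rewrite /Rintegral.
  have -> : (\int[lebesgue_tuple R n.+1]_(x in [set r | (enorm r <= delta)%R])
      (complex.Im ((rho (enorm x))%:C *
         (expi (dotp (real_tuple R k) x) - 1)))%:E)%E =
    (\int[lebesgue_tuple R n.+1]_(x in [set r | (enorm r <= delta)%R])
      (rho (enorm x) * sin (dotp (real_tuple R k) x))%:E)%E.
    by apply: eq_integral => x _ /=; congr EFin; ring.
  by case: (spectrum_im rho_measurable rho_ge0 (real_tuple R k)) => ->.
Qed.
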